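(* Let $n\ge 4$ and consider the TSP instance $G_1$ on the complete graph with vertex set $V=\{1,\dots,n\}$ whose distance function is $d(\{i,i+1\})=1$ for $i=1,\dots,n-1$, $d(\{n,1\})=1$, and $d(e)=n$ for every other edge $e$; its unique optimal Hamiltonian cycle is $s^*=(1,2,\dots,n)$. Run the cross-entropy algorithm described in the context (with $M=1$, $\rho=1$, $\pi_{\min}=\frac{1}{n(n-2)}$, $\pi_{\max}=1-\frac1n$) on this instance. Then, as $n\to\infty$: (a) if the vertex-based random solution generation is used and the sample size satisfies $N\in\Omega(n^{5+\epsilon})$ for a constant $\epsilon\in(0,1)$, then with probability at least $1-e^{-\Omega(N/n^{5})}$ the optimal solution $s^*$ is found within $n$ iterations; (b) if the edge-based random solution generation is used and $N\in\Omega(n^{3+\epsilon})$ for a constant $\epsilon\in(0,1)$, then with probability at least $1-e^{-\Omega(N/n^{3})}$ the optimal solution $s^*$ is found within $n$ iterations.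
   Context: Let $K_n$ be the complete graph on $V=\{1,\dots,n\}$ with edge set $E$ of all 2-element subsets. A feasible solution is a Hamiltonian cycle of $K_n$ (identified with any permutation listing its vertices in cyclic order); its cost $f(s)$ is the sum of $d$ over its $n$ edges. For a Hamiltonian cycle $H$, let $\Pi^H=(\pi_{i,j})$ be the symmetric $n\times n$ matrix with $\pi_{i,i}=0$, $\pi_{i,j}=\pi_{\max}=1-\frac1n$ if $\{i,j\}\in H$ and $\pi_{i,j}=\pi_{\min}=\frac{1}{n(n-2)}$ otherwise. Vertex-based generation from a matrix $\Pi$: pick a start vertex uniformly at random; while unvisited vertices remain, from the current vertex $v$ move to an unvisited vertex $v'$ chosen with probability $\pi_{v,v'}/\sum_{k\text{ unvisited}}\pi_{v,k}$; output the Hamiltonian cycle visiting vertices in this order. Edge-based generation from $\Pi$: start with $B=\emptyset$ and repeatedly add to $B$ an edge $\{i,j\}\notin B$ chosen among the admissible edges with probability proportional to $\pi_{i,j}+\pi_{j,i}$, until $B$ is a Hamiltonian cycle; an edge is admissible if adding it to $B$ creates no vertex of degree $\ge3$ and no cycle with fewer than $n$ edges. The algorithm: $\Pi_0$ has all off-diagonal entries $\frac{1}{n-1}$ (zero diagonal). In iteration $t=0,1,2,\dots$, generate $N$ independent random solutions $X_t^{(1)},\dots,X_t^{(N)}$ from $\Pi_t$ with the chosen generation method, let $X_t^{[1]}$ be one of them of minimum cost, and set $\Pi_{t+1}=\Pi^{X_t^{[1]}}$ (this is the cross-entropy update with elite size $M=1$, smoothing parameter $\rho=1$, followed by max-min calibration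 clamping entries into $[\pi_{\min},\pi_{\max}]$). The optimal solution is found within $T$ iterations if $X_t^{[1]}$ is optimal for some $t\le T$. Asymptotic notation refers to $n\to\infty$, with $N=N(n)$. *)

(* Defs.v *)
From HB Require Import structures.
From mathcomp Require Import all_boot all_order all_algebra all_fingroup.
From mathcomp Require Import all_classical all_reals all_analysis.
Set Implicit Arguments. Unset Strict Implicit. Unset Printing Implicit Defensive.
Import Order.TTheory GRing.Theory Num.Theory.
Local Open Scope ring_scope.

(* Vertices of K_n are 'I_n = {0,...,n-1} (vertex i+1 of the paper is i here).
   Edges are 2-element subsets {set 'I_n}; a (candidate) solution is an edge
   set {set {set 'I_n}}.  A Hamiltonian cycle is the edge set of a cyclic
   ordering of all vertices. *)

Definition cyc_edges (n : nat) (s : {perm 'I_n}) : {set {set 'I_n}} :=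
  [set [set s i; s (ordS i)] | i : 'I_n].

Definition is_ham (n : nat) (H : {set {set 'I_n}}) : bool :=
  [exists s : {perm 'I_n}, H == cyc_edges s].

Definition distG1 (R : realType) (n : nat) (e : {set 'I_n}) : R :=
  if [exists i : 'I_n, e == [set i; ordS i]] then 1 else n%:R.

Definition cost (R : realType) (n : nat) (H : {set {set 'I_n}}) : R :=
  \sum_(e in H) distG1 R e.

Definition is_optimal (R : realType) (n : nat) (H : {set {set 'I_n}}) : bool :=
  is_ham H && [forall H' : {set {set 'I_n}}, is_ham H' ==> (cost R H <= cost R H')].

Definition pi_min (R : realType) (n : nat) : R := ((n * (n - 2))%N%:R)^-1.
Definition pi_max (R : realType) (n : nat) : R := 1 - (n%:R)^-1.

Definition Pi_of (R : realType) (n : nat) (H : {set {set 'I_n}}) : 'I_n -> 'I_n -> R :=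
  fun i j => if i == j then 0
             else if [set i; j] \in H then @pi_max R n else @pi_min R n.

Definition Pi0 (R : realType) (n : nat) : 'I_n -> 'I_n -> R :=
  fun i j => if i == j then 0 else ((n.-1)%:R)^-1.

(* probability of the continuation of a walk from v visiting the vertices of
   rest in this order; at each step rest is exactly the set of unvisited
   vertices *)
Fixpoint path_prob (R : realType) (n : nat) (P : 'I_n -> 'I_n -> R)
  (v : 'I_n) (rest : seq 'I_n) : R :=
  match rest with
  | [::] => 1
  | w :: rest' => P v w / (\sum_(u <- rest) P v u) * path_prob P w rest'
  end.

Definition order_prob (R : realType) (n : nat) (P : 'I_n -> 'I_n -> R)
  (s : {perm 'I_n}) : R :=
  match [seq s i | i <- enum 'I_n] with
  | [::] => 0
  | v :: rest => (n%:R)^-1 * path_prob P v rest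
  end.

Definition vgen (R : realType) (n : nat) (P : 'I_n -> 'I_n -> R)
  (H : {set {set 'I_n}}) : R :=
  \sum_(s : {perm 'I_n} | cyc_edges s == H) order_prob P s.

Definition ew (R : realType) (n : nat) (P : 'I_n -> 'I_n -> R) (e : {set 'I_n}) : R :=
  \sum_(i in e) \sum_(j in e | i != j) P i j.   (* = pi_ij + pi_ji for e = {i,j} *)

Definition has_cycle_lt (n : nat) (B : {set {set 'I_n}}) : bool :=
  [exists k : 'I_n, (2 < k)%N &&
     [exists f : {ffun 'I_k -> 'I_n},
        injectiveb f && [forall i : 'I_k, [set f i; f (ordS i)] \in B]]].

Definition admissible (n : nat) (B : {set {set 'I_n}}) (e : {set 'I_n}) : bool :=
  [&& #|e| == 2%N, e \notin B,
      [forall v : 'I_n, #|[set x in e |: B | v \in x]| <= 2]%N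
    & ~~ has_cycle_lt (e |: B)].

Definition Zadm (R : realType) (n : nat) (P : 'I_n -> 'I_n -> R)
  (B : {set {set 'I_n}}) : R :=
  \sum_(e : {set 'I_n} | admissible B e) ew P e.

Fixpoint eseq_prob (R : realType) (n : nat) (P : 'I_n -> 'I_n -> R)
  (B : {set {set 'I_n}}) (es : seq {set 'I_n}) : R :=
  match es with
  | [::] => 1
  | e :: es' => (if admissible B e then ew P e / Zadm P B else 0)
                * eseq_prob P (e |: B) es'
  end.

(* the process stops after exactly n admissible additions (a Hamiltonian
   cycle has n edges); distribution of the final edge set *)
Definition egen (R : realType) (n : nat) (P : 'I_n -> 'I_n -> R)
  (H : {set {set 'I_n}}) : R :=
  \sum_(t : n.-tuple {set 'I_n} | [set x | x \in t] == H) eseq_prob P finset.set0 t.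

(* tie-breaking rule: given the iteration t and the N samples, returns the
   index of the chosen best sample *)
Definition selector (n N : nat) := nat -> {ffun 'I_N -> {set {set 'I_n}}} -> 'I_N.

Definition valid_selector (R : realType) (n N : nat) (sel : selector n N) : Prop :=
  forall t (X : {ffun 'I_N -> {set {set 'I_n}}}) (j : 'I_N),
    cost R (X (sel t X)) <= cost R (X j).

Definition sample_prob (R : realType) (n N : nat)
  (gen : ('I_n -> 'I_n -> R) -> {set {set 'I_n}} -> R)
  (P : 'I_n -> 'I_n -> R) (X : {ffun 'I_N -> {set {set 'I_n}}}) : R :=
  \prod_(j < N) gen P (X j).

Fixpoint succ_prob (R : realType) (n N : nat)
  (gen : ('I_n -> 'I_n -> R) -> {set {set 'I_n}} -> R)
  (sel : selector n N) (k t : nat) (P : 'I_n -> 'I_n -> R) {struct k} : R :=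
  \sum_(X : {ffun 'I_N -> {set {set 'I_n}}})
    sample_prob gen P X *
    (if is_optimal R (X (sel t X)) then 1
     else match k with
          | 0 => 0
          | k'.+1 => succ_prob gen sel k' t.+1 (Pi_of R (X (sel t X)))
          end).

(* probability that the optimum is found within T iterations (t <= T) *)
Definition prob_found_within (R : realType) (n N : nat)
  (gen : ('I_n -> 'I_n -> R) -> {set {set 'I_n}} -> R)
  (sel : selector n N) (T : nat) : R :=
  succ_prob gen sel T 0 (@Pi0 R n).

(* Main.v *)
(** Every non-optimal tour [H] has an improvement [H'] at bounded distance: for an optimal edge
    [e] missing from [H], a 2- or 3-exchange inserts [e] and keeps all optimal edges of [H].  The
    cost of a tour is an affine decreasing function of its number of optimal edges, so that once
    every iteration samples such an improvement, [n] iterations reach the optimum.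

    Vertex-based: start the listing of [H'] so that its closing edge is new.  It leaves [H] at most
    twice, with probability of order [n^-2] each time; steps along [H] have probability at least
    [1 - 1/n], except for the first one and those after a jump.  With the choice of the start
    vertex this gives [n^-5].

    Edge-based: at each time where [r] edges are missing, [e] is picked with probability of order
    [n^-2 / r], and then all remaining edges of [H] and [H'] are picked before the one edge of [H]
    that would close a short cycle with [e], with probability of order [1 / r].  Summing over all
    orders gives [n^-3].  The edges outside [H] are harmless because at most [2 r^2] of them are
    admissible.

    One iteration hence fails with probability at most [exp (- c N / n^d)], and [N] is large enough
    to absorb the factor [n] of the union bound. *)
Require Import Defs.
From HB Require Import structures.
From mathcomp Require Import all_boot all_order all_algebra all_fingroup zify reals ring lra.
Set Implicit Arguments. Unset Strict Implicit. Unset Printing Implicit Defensive.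
Import Order.TTheory GRing.Theory Num.Theory.

(** * Edge sets of paths, Hamiltonian cycles *)

Section PathEdges.
Variable T : finType.
Implicit Types (x y : T) (s t : seq T) (H : {set {set T}}).

Fixpoint pth x s : {set {set T}} :=
  if s is y :: s' then [set x; y] |: pth y s' else set0.

Definition cyc s : {set {set T}} := if s is x :: s' then pth x (rcons s' x) else set0.

(** Each jump is a step of weight [pi_min] in the matrix of [H], so their number decides the order
    of magnitude of [path_prob]. *)
Fixpoint jumps H x s : nat :=
  if s is y :: s' then ([set x; y] \notin H) + jumps H y s' else 0.

Lemma pth_cat x s t : pth x (s ++ t) = pth x s :|: pth (last x s) t.
Proof. by elim: s x => [|y s IHs] x /=; rewrite ?set0U // IHs setUA. Qed.

Lemma pth_rcons x s y : pth x (rcons s y) = [set last x s; y] |: pth x s.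
Proof. by rewrite -cats1 pth_cat /= setU0 setUC. Qed.

Lemma rev_lastI x s : rev (x :: s) = last x s :: rev (belast x s).
Proof. by rewrite lastI rev_rcons. Qed.

Lemma last_rev_belast x s : last (last x s) (rev (belast x s)) = x.
Proof. by case: s => //= y s; rewrite rev_cons last_rcons. Qed.

Lemma pth_rev x s : pth (last x s) (rev (belast x s)) = pth x s.
Proof.
elim: s x => [|y s IHs] x //=.
rewrite rev_cons pth_rcons IHs last_rev_belast.
by congr (_ |: _); rewrite setUC.
Qed.

Lemma pthP x s e :
  reflect (exists2 i, i < size s & e = [set nth x (x :: s) i; nth x (x :: s) i.+1])
          (e \in pth x s).
Proof.
apply: (iffP idP).
  elim: s x => [|y s IHs] x; first by rewrite inE.
  rewrite in_setU1 => /orP[/eqP-> | /IHs[i ltis ->]]; first by exists 0.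
  exists i.+1 => //=; congr (_ |: [set _]); last exact: set_nth_default.
  by apply: set_nth_default; exact: leqW.
case=> i ltis ->; elim: s x i ltis => [|y s IHs] x i; first by [].
case: i => [|i] ltis; first by rewrite /= setU11.
rewrite [pth _ _]/= in_setU1; apply/orP; right; rewrite /=.
have -> : nth x (y :: s) i = nth y (y :: s) i by apply: set_nth_default; exact: ltnW.
by rewrite (@set_nth_default _ s y x i ltis); apply: IHs.
Qed.

Lemma cyc_cons x s : cyc (x :: s) = [set last x s; x] |: pth x s.
Proof. exact: pth_rcons. Qed.

Lemma cyc_catC s t : cyc (s ++ t) = cyc (t ++ s).
Proof.
case: s t => [|x s] [|y t]; rewrite ?cats0 //.
rewrite !cat_cons !cyc_cons !last_cat !pth_cat /=.
by apply/setP=> e; rewrite !inE; do ?case: (_ == _); do ?case: (_ \in _).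
Qed.

Lemma cyc_rot i s : cyc (rot i s) = cyc s.
Proof. by rewrite /rot cyc_catC cat_take_drop. Qed.

Lemma cyc_rev s : cyc (rev s) = cyc s.
Proof.
case: s => [|x s] //; rewrite rev_lastI !cyc_cons last_rev_belast pth_rev.
by congr (_ |: _); rewrite setUC.
Qed.

(** At [i = size s] the index [i.+1] runs past the end, and the default [x] turns the pair into the
    closing edge. *)
Lemma cycP x s e :
  reflect (exists2 i, i <= size s & e = [set nth x (x :: s) i; nth x (x :: s) i.+1])
          (e \in cyc (x :: s)).
Proof.
apply: (iffP (pthP _ _ _)); rewrite size_rcons => -[i lei ->]; exists i => //=;
  by case: i lei => [|i] lei /=; rewrite ?nth_rcons_default.
Qed.

Lemma jumps_cat H x s t : jumps H x (s ++ t) = jumps H x s + jumps H (last x s) t.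
Proof. by elim: s x => [|y s IHs] x //=; rewrite IHs addnA. Qed.

Lemma jumps_sub H x s : pth x s \subset H -> jumps H x s = 0.
Proof.
elim: s x => [|y s IHs] x //=; rewrite subUset sub1set => /andP[-> /IHs->] //.
Qed.

Lemma pth_notsub x s H : ~~ (pth x s \subset H) ->
  exists p q t, s = p ++ q :: t /\ [set last x p; q] \notin H.
Proof.
case/subsetPn=> e /pthP[i ltis ->] eNH.
exists (take i s), (nth x s i), (drop i.+1 s); split.
  by rewrite -drop_nth ?cat_take_drop.
suff -> : last x (take i s) = nth x (x :: s) i by [].
case: i ltis {eNH} => [|i] ltis; first by rewrite take0.
by rewrite (take_nth x) ?last_rcons // ltnW.
Qed.

End PathEdges.

(** * Hamiltonian cycles as vertex lists; degrees, short cycles and admissibility *)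

Section Hamiltonian.
Variable n : nat.
Implicit Types (u v x : 'I_n) (s l : seq 'I_n) (e : {set 'I_n}) (B H : {set {set 'I_n}}).

Lemma ordSE (i : 'I_n) : ordS i = i.+1 %% n :> nat. Proof. by []. Qed.

Lemma listing_uniq (s : {perm 'I_n}) : uniq [seq s i | i <- enum 'I_n].
Proof. by rewrite map_inj_uniq ?enum_uniq //; apply: perm_inj. Qed.

Lemma size_listing (s : {perm 'I_n}) : size [seq s i | i <- enum 'I_n] = n.
Proof. by rewrite size_map size_enum_ord. Qed.

Lemma uniq_full l : uniq l -> size l = n -> forall x, x \in l.
Proof.
move=> Ul szl x; have eq_card : #|l| = #|'I_n| by rewrite (card_uniqP Ul) szl card_ord.
by have /(_ x) -> := subset_cardP eq_card (subset_predT _).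
Qed.

Lemma listingP l : uniq l -> size l = n ->
  exists s : {perm 'I_n}, [seq s i | i <- enum 'I_n] = l.
Proof.
case: l => [|x l] Ul szl.
  exists 1%g; apply: size0nil; by rewrite size_listing.
have injf : injective (fun i : 'I_n => nth x (x :: l) i).
  move=> i j /eqP; rewrite nth_uniq ?szl ?ltn_ord // => /eqP; exact: val_inj.
exists (perm injf); apply: (@eq_from_nth _ x); first by rewrite size_listing szl.
move=> i; rewrite size_listing => ltin.
rewrite (nth_map (Ordinal ltin)) ?size_enum_ord // permE.
by rewrite nth_enum_ord.
Qed.

(** Passes from permutations to lists, which can be rotated, reversed and spliced. *)
Lemma cyc_edgesE (s : {perm 'I_n}) : cyc_edges s = cyc [seq s i | i <- enum 'I_n].
Proof.
move def_l: [seq _ | _ <- _] => l; have szl: size l = n by rewrite -def_l size_listing.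
have nthl x (i : 'I_n) : nth x l i = s i.
  by rewrite -def_l (nth_map i) ?size_enum_ord // nth_ord_enum.
clear def_l; case: l => [|x l] in szl nthl *.
  by apply/setP=> e; rewrite inE; apply/imsetP=> -[[i lti] _ _]; rewrite -szl in lti.
have nthS (i : 'I_n) : nth x (x :: l) i.+1 = s (ordS i).
  rewrite -(nthl x) ordSE; have := ltn_ord i; rewrite leq_eqVlt => /orP[/eqP->|lti].
    by rewrite modnn nth_default // szl.
  by rewrite modn_small.
apply/setP=> e; apply/imsetP/cycP=> [[i _ ->] | [i]].
  exists (val i); last by rewrite nthl nthS.
  by rewrite -ltnS -[(size l).+1]/(size (x :: l)) szl ltn_ord.
rewrite -ltnS -[(size l).+1]/(size (x :: l)) szl => lti ->; exists (Ordinal lti) => //.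
by rewrite -nthS -(nthl x).
Qed.

Lemma ham_listP H :
  reflect (exists l, [/\ uniq l, size l = n & H = cyc l]) (is_ham H).
Proof.
apply: (iffP existsP) => [[s /eqP->] | [l [Ul szl ->]]].
  exists [seq s i | i <- enum 'I_n].
  by rewrite listing_uniq size_listing cyc_edgesE.
by have [s <-] := listingP Ul szl; exists s; rewrite cyc_edgesE.
Qed.

Lemma ham_start H u : is_ham H -> exists s, [/\ uniq (u :: s), (size s).+1 = n & H = cyc (u :: s)].
Proof.
case/ham_listP=> l [Ul szl ->]; have [i s def_s] := rot_to (uniq_full Ul szl u).
exists s; rewrite -def_s rot_uniq cyc_rot; split=> //.
by rewrite -[RHS]szl -(size_rot i l) def_s.
Qed.

Lemma ham_edge2 H e : 1 < n -> is_ham H -> e \in H -> #|e| = 2.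
Proof.
move=> n_gt1 /existsP[s /eqP->] /imsetP[i _ ->]; rewrite cards2 (inj_eq perm_inj).
suff ->: i != ordS i by [].
apply/eqP=> /(congr1 val) /=; have := ltn_ord i; rewrite leq_eqVlt => /orP[/eqP def_n|lti].
  by rewrite def_n modnn => i0; rewrite -def_n i0 in n_gt1.
by rewrite modn_small //; lia.
Qed.

(** If two positions gave the same edge, each would be the successor of the other, which needs
    [n <= 2]. *)
Lemma card_ham H : 2 < n -> is_ham H -> #|H| = n.
Proof.
move=> n_gt2 /existsP[s /eqP->]; rewrite card_imset ?card_ord // => i j eq_ij.
have: s i \in [set s j; s (ordS j)] by rewrite -eq_ij !inE eqxx.
have: s j \in [set s i; s (ordS i)] by rewrite eq_ij !inE eqxx.
rewrite !inE !(inj_eq perm_inj) => /orP[/eqP-> // | /eqP jSi] /orP[/eqP // | /eqP iSj].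
have/(congr1 val) := jSi; have /(congr1 val) := iSj; rewrite /=.
have := ltn_ord i; have := ltn_ord j; rewrite leq_eqVlt => /orP[/eqP Ej|ltj];
  rewrite leq_eqVlt => /orP[/eqP Ei|lti].
- by move=> _ _; apply: val_inj; apply: succn_inj; rewrite Ei Ej.
- by rewrite Ej modnn modn_small //; lia.
- by rewrite Ei modnn modn_small //; lia.
by rewrite !modn_small //; lia.
Qed.

Lemma sub_ham_eq H B : 2 < n -> is_ham H -> B \subset H -> n <= #|B| -> B = H.
Proof.
by move=> n_gt2 hamH sBH le_n; apply/eqP; rewrite eqEcard sBH /= (card_ham n_gt2 hamH).
Qed.

Definition edges_at B v := [set x in B | v \in x].

Lemma ham_deg H v : is_ham H -> #|edges_at H v| <= 2.
Proof.
case/existsP=> s /eqP->; pose k := (s^-1)%g v.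
pose E i := [set s i; s (ordS i)].
have sub: edges_at (cyc_edges s) v \subset [set E k; E (ord_pred k)].
  apply/subsetP=> x; rewrite inE => /andP[/imsetP[i _ ->]].
  rewrite !inE => /orP[] /eqP v_s; first by rewrite /k v_s permK eqxx.
  by rewrite /k v_s permK ordSK eqxx orbT.
by rewrite (leq_trans (subset_leq_card sub)) // cards2; case: (_ == _).
Qed.

Lemma edges_at_subset B (C : {set {set 'I_n}}) v : B \subset C -> edges_at B v \subset edges_at C v.
Proof.
by move/subsetP=> sBC; apply/subsetP=> e; rewrite !inE => /andP[/sBC-> ->].
Qed.

Lemma set2_injl (T : finType) (x y z : T) : [set x; y] = [set x; z] -> y = z.
Proof.
move=> eqs; have: y \in [set x; z] by rewrite -eqs !inE eqxx orbT.
have: z \in [set x; y] by rewrite eqs !inE eqxx orbT.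
by rewrite !inE => /orP[/eqP zx|/eqP->//] /orP[/eqP yx|/eqP->//]; rewrite zx yx.
Qed.

(** Each vertex of a shorter cycle inside [H] spends its degree 2 on that cycle. The vertex set is
    thus closed under the successor along [H], hence contains all [n] vertices, against [k < n]. *)
Lemma ham_no_short H : is_ham H -> ~~ has_cycle_lt H.
Proof.
move=> hamH; apply/existsP=> -[k /andP[k_gt2 /existsP[f /andP[/injectiveP injf /forallP fH]]]].
have /existsP[s /eqP defH] := hamH.
pose S := [set f i | i : 'I_k].
have E_H j : [set s j; s (ordS j)] \in H by rewrite defH; apply/imsetP; exists j.
have clS j : s j \in S -> s (ordS j) \in S.
  case/imsetP=> i _ def_sj.
  have fP := fH (ord_pred i); rewrite ord_predK in fP.
  have f_neq : f (ordS i) != f (ord_pred i).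
    rewrite (inj_eq injf); apply/eqP=> /(congr1 (@ordS k)); rewrite ord_predK => /(congr1 val) /=.
    have := ltn_ord i; rewrite leq_eqVlt => /orP[/eqP Ei|lti].
      by rewrite Ei modnn modn_small; lia.
    rewrite (modn_small lti); move: lti; rewrite leq_eqVlt => /orP[/eqP Ei|lti].
      by rewrite Ei modnn; lia.
    by rewrite modn_small //; lia.
  (* A successor outside [S] would give [s j] a third edge of [H]. *)
  apply: contraT => sSN.
  have: #|[set [set f i; f (ordS i)]; [set f i; f (ord_pred i)]; [set s j; s (ordS j)]]| <= 2.
    apply: leq_trans (ham_deg (s j) hamH); apply: subset_leq_card.
    apply/subsetP=> e; rewrite !inE -orbA => /or3P[] /eqP->; rewrite ?E_H ?fH def_sj ?inE ?eqxx //.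
    by rewrite setUC fP.
  have sN i' : s (ordS j) != f i'.
    by apply: contra sSN => /eqP->; apply: imset_f.
  rewrite -setUA !cardsU1 cards1 !inE def_sj.
  have -> : [set f i; f (ordS i)] == [set f i; f (ord_pred i)] = false.
    by apply/eqP=> /set2_injl /eqP; rewrite (negPf f_neq).
  have N i' : [set f i; f i'] == [set f i; s (ordS j)] = false.
    by apply/eqP=> /set2_injl /eqP; rewrite eq_sym (negPf (sN _)).
  by rewrite !N.
have k_gt0 : 0 < k by lia.
have n_gt0 : 0 < n by have := ltn_ord k; lia.
pose i0 : 'I_k := Ordinal k_gt0; pose j0 : 'I_n := (s^-1)%g (f i0).
have allS m : s (iter m (@ordS n) j0) \in S.
  by elim: m => [|m /clS] //=; rewrite /j0 permKV imset_f.
have iterE m : iter m (@ordS n) j0 = (j0 + m) %% n :> nat.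
  elim: m => [|m IHm] /=; first by rewrite addn0 modn_small.
  by rewrite IHm addnS -addn1 modnDml addn1.
have: #|S| = n.
  suff ->: S = [set: 'I_n] by rewrite cardsT card_ord.
  apply/setP=> v; rewrite inE; pose j := (s^-1)%g v.
  have <-: s (iter (j + (n - j0)) (@ordS n) j0) = v.
    rewrite -[RHS](permKV s); congr (s _); apply: val_inj; rewrite [LHS]iterE -/j.
    have -> : j0 + (j + (n - j0)) = j + n by have := ltn_ord j0; lia.
    by rewrite modnDr modn_small.
  exact: allS.
rewrite card_imset // card_ord => kn; have := ltn_ord k; by rewrite kn ltnn.
Qed.

Lemma has_cycle_lt_subset B (C : {set {set 'I_n}}) : B \subset C -> has_cycle_lt B -> has_cycle_lt C.
Proof.
move/subsetP=> sBC /existsP[k /andP[k_gt2 /existsP[f /andP[injf /forallP fB]]]].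
apply/existsP; exists k; rewrite k_gt2; apply/existsP; exists f; rewrite injf.
by apply/forallP=> i; apply: sBC.
Qed.

Lemma admissible_ham H B e :
  1 < n -> is_ham H -> e |: B \subset H -> e \notin B -> admissible B e.
Proof.
move=> n_gt1 hamH sBH eNB.
have eH : e \in H by rewrite (subsetP sBH) ?setU11.
rewrite /admissible (ham_edge2 n_gt1 hamH eH) eqxx eNB /=; apply/andP; split.
  apply/forallP=> v; apply: leq_trans (ham_deg v hamH).
  exact/subset_leq_card/edges_at_subset.
exact: contra (has_cycle_lt_subset sBH) (ham_no_short hamH).
Qed.

Lemma admissible_subset B (C : {set {set 'I_n}}) e :
  B \subset C -> e \notin B -> admissible C e -> admissible B e.
Proof.
move=> sBC eNB /and4P[e2 _ /forallP degC cycC]; rewrite /admissible e2 eNB /=.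
have sBC' := setUS [set e] sBC; apply/andP; split; last exact: contra (has_cycle_lt_subset sBC') cycC.
apply/forallP=> v; apply: leq_trans (degC v); exact/subset_leq_card/edges_at_subset.
Qed.

Lemma not_admissible_deg B a e (g : {set 'I_n}) v : a \in B -> e \in B -> a != e ->
  v \in a -> v \in e -> v \in g -> ~~ admissible B g.
Proof.
move=> aB eB neq va ve vg; apply/negP=> /and4P[_ gNB /forallP/(_ v) + _].
apply/negP; rewrite -ltnNge.
have: [set a; e; g] \subset [set x in g |: B | v \in x].
  by apply/subsetP=> x; rewrite !inE -orbA => /or3P[]/eqP->; rewrite ?aB ?eB ?va ?ve ?vg ?orbT ?eqxx.
move/subset_leq_card; apply: leq_trans; rewrite -setUA !cardsU1 cards1 !inE negb_or neq.
have ag: a != g by apply: contraNneq gNB => <-.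
have eg: e != g by apply: contraNneq gNB => <-.
by rewrite ag eg.
Qed.

Lemma has_cycle_lt_list v s B : 1 < size s -> (size s).+1 < n -> uniq (v :: s) ->
  cyc (v :: s) \subset B -> has_cycle_lt B.
Proof.
move=> s_gt1 s_ltn Us /subsetP sB; pose k := Ordinal s_ltn.
apply/existsP; exists k; rewrite [2 < _]s_gt1.
apply/existsP; exists [ffun i : 'I_k => nth v (v :: s) i]; apply/andP; split.
  apply/injectiveP=> i j; rewrite !ffunE => /eqP; rewrite nth_uniq // => /eqP; exact: val_inj.
apply/forallP=> i; apply: sB; apply/cycP; exists (val i); first exact: (ltn_ord i).
suff -> : nth v (v :: s) (val i).+1 = nth v (v :: s) (val (ordS i)) by rewrite !ffunE.
have [lti|] := ltnP (val i).+1 (size s).+1; first by rewrite [val (ordS i)]modn_small.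
move=> gei; have Ei : (val i).+1 = (size s).+1 by apply/eqP; rewrite eqn_leq gei andbT (ltn_ord i).
have Ek : val (ordS i) = 0 by rewrite -[LHS]/((val i).+1 %% (size s).+1) Ei modnn.
by rewrite Ei Ek nth_default.
Qed.

End Hamiltonian.

(** * Exchanges *)

Section Exchange.
Variable n : nat.
Implicit Types (u v x : 'I_n) (s l : seq 'I_n) (e : {set 'I_n}) (B H : {set {set 'I_n}}).

(* [H'] arises from [H] by a 2- or 3-exchange forcing the edge [e] in.  The lost edges are [g1],
   [g2], [g3]; once the kept edges [a], [b] and [e] are present, [g1] and [g2] are blocked by
   degrees, and [g3] is blocked at the latest when all of [H :&: H'] is present.  The closing edge
   of the listing [x :: l] of [H'] is new, so that its path jumps at most twice out of [H]. *)
Record exchange H e H' g1 g2 g3 a b : Prop := Exchange {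
  ex_listing : exists x l, [/\ uniq (x :: l), (size l).+1 = n, H' = cyc (x :: l)
                             & jumps H x l <= 2];
  ex_new : e \in H';
  ex_lost : H :\: H' \subset [set g1; g2; g3];
  ex_a : a \in H :&: H';
  ex_b : b \in H :&: H';
  ex_ab : a != b;
  ex_g1 : forall B, a \in B -> e \in B -> ~~ admissible B g1;
  ex_g2 : forall B, b \in B -> e \in B -> ~~ admissible B g2;
  ex_g3 : ~~ admissible (e |: (H :&: H')) g3 }.

(** [B] is arbitrary for two uses: the optimal edges of [H] when a tour is improved, and the current
    set of the edge-based process when it is extended to a tour. *)
Definition exchangeable H B e :=
  exists H' g1 g2 g3 a b, exchange H e H' g1 g2 g3 a b /\ e |: B \subset H'.

Lemma set2_neq (T : finType) (x y z t : T) : x != z -> x != t -> [set x; y] != [set z; t].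
Proof.
move=> xz xt; apply/eqP=> eqs; have: x \in [set z; t] by rewrite -eqs !inE eqxx.
by rewrite !inE (negPf xz) (negPf xt).
Qed.

(** Two arcs, from [u] through [a0] to [v] and from [v] through [c0] back to [u]. The four edges at
    [u] and [v] are isolated because the exchanges act on them. *)
Lemma cyc_split u v a0 s c0 t :
  cyc (u :: a0 :: s ++ v :: c0 :: t) =
  [set u; a0] |: (pth a0 s :|: ([set last a0 s; v] |:
    ([set v; c0] |: pth c0 t :|: [set [set last c0 t; u]]))).
Proof.
rewrite cyc_cons /= last_cat pth_cat /=.
by apply/setP=> f; rewrite !inE; do ?(case: (_ == _); rewrite /= ?orbT ?orbF //);
  do ?(case: (_ \in _); rewrite /= ?orbT ?orbF //).
Qed.

Lemma uniq_split u v s t : uniq (u :: s ++ v :: t) ->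
  [/\ [/\ u != v, {in s, forall w, w != u} & {in t, forall w, w != u}],
      {in s, forall w, w != v} /\ {in t, forall w, w != v}
    & {in s & t, forall w w', w != w'}].
Proof.
rewrite cons_uniq mem_cat inE !negb_or cat_uniq cons_uniq /= negb_or.
case/and5P=> /and3P[us uv ut] _ /andP[vs /hasPn disj] vt _.
have N (w x : 'I_n) (r : seq 'I_n) : x \notin r -> w \in r -> w != x.
  by move=> xr wr; apply: contraNneq xr => <-.
split; [split=> // w | split=> w | move=> w w' w_in w'_in].
- exact: N. - exact: N. - exact: N. - exact: N.
by apply: N w_in; apply: disj.
Qed.

(** The arc [a0 :: s] is reversed: [[set u; a0]] and [[set v; c0]] give way to [[set u; v]] and
    [[set a0; c0]]. Each lost edge is blocked by the degree of [u] or [v]. *)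
Lemma two_exchange H B u v a0 s c0 t :
  uniq (u :: a0 :: s ++ v :: c0 :: t) -> size (u :: a0 :: s ++ v :: c0 :: t) = n ->
  H = cyc (u :: a0 :: s ++ v :: c0 :: t) -> B \subset H -> [set u; v] \notin H ->
  [set u; a0] \notin B -> [set v; c0] \notin B -> exchangeable H B [set u; v].
Proof.
move=> Us szs defH sBH eNH g1NB g2NB; rewrite cyc_split in defH.
pose a1 := last a0 s; pose c1 := last c0 t.
have [a1_in c1_in] : a1 \in a0 :: s /\ c1 \in c0 :: t by rewrite !mem_last.
(* Starting at [c0] makes [[set a0; c0]] the closing edge, so that [[set u; v]] is the only possible
   jump. *)
pose l := t ++ u :: v :: a1 :: rev (belast a0 s).
have rev_s : rev (a0 :: s) = a1 :: rev (belast a0 s) by rewrite rev_lastI.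
have perm_l : perm_eq (c0 :: l) (u :: a0 :: s ++ v :: c0 :: t).
  rewrite /l -rev_s; apply/seq.permP=> p; rewrite /= !(count_cat, count_rev) /= !(count_cat, count_rev) /=.
  move: (nat_of_bool (p u)) (nat_of_bool (p v)) (nat_of_bool (p a0)) (nat_of_bool (p c0)); clear=> *; lia.
pose H' := cyc (c0 :: l).
have defH' : H' = pth c0 t :|: ([set c1; u] |: ([set u; v] |: ([set v; a1] |:
                  (pth a0 s :|: [set [set a0; c0]])))).
  rewrite /H' cyc_cons /l last_cat /= last_rev_belast pth_cat /= pth_rev.
  by apply/setP=> f; rewrite !inE; do ?(case: (_ == _); rewrite /= ?orbT ?orbF //);
    do ?(case: (_ \in _); rewrite /= ?orbT ?orbF //).
have lost : H :\: H' \subset [set [set u; a0]; [set v; c0]; [set u; a0]].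
  rewrite defH defH' (setUC [set v] [set a1]); apply/subsetP=> f; rewrite !inE.
  by do ?(case: (_ == _); rewrite /= ?orbT ?orbF //); do ?(case: (_ \in _); rewrite /= ?orbT ?orbF //).
have [[uv uA uC] [vA vC] AC] := @uniq_split u v (a0 :: s) (c0 :: t) Us.
have blocked1 (C : {set {set 'I_n}}) : [set c1; u] \in C -> [set u; v] \in C -> ~~ admissible C [set u; a0].
  move=> aC eC; apply: (not_admissible_deg aC eC (v := u)); rewrite ?inE ?eqxx ?orbT //.
  by rewrite set2_neq ?uC ?vC.
(* Only two edges are lost; the first also fills the place of [g3]. *)
exists H', [set u; a0], [set v; c0], [set u; a0], [set c1; u], [set a1; v]; split; first split.
- exists c0, l; split=> //; first by rewrite (perm_uniq perm_l).
    by rewrite -[RHS]szs -(perm_size perm_l).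
  have sub_t : pth c0 t \subset H.
    by apply/subsetP=> f fp; rewrite defH !inE fp !orbT.
  have sub_s : pth a0 s \subset H.
    by apply/subsetP=> f fp; rewrite defH !inE fp !orbT.
  rewrite /l jumps_cat jumps_sub //= (jumps_sub (s := rev _)) ?pth_rev //.
  have -> : [set c1; u] \in H by rewrite defH !inE eqxx !orbT.
  have -> : [set v; a1] \in H by rewrite setUC defH !inE eqxx !orbT.
  by case: (_ \in _).
- by rewrite defH' !inE eqxx !orbT.
- exact: lost.
- by rewrite defH defH' !inE eqxx !orbT.
- by rewrite defH defH' (setUC [set v] [set a1]) !inE eqxx !orbT.
- by rewrite (setUC [set c1]) set2_neq // eq_sym uA.
- exact: blocked1.
- move=> C bC eC; apply: (not_admissible_deg bC eC (v := v)); rewrite ?inE ?eqxx ?orbT //.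
  by rewrite set2_neq ?uA ?vA.
- apply: blocked1; last exact: setU11.
  by rewrite defH defH' !inE eqxx !orbT.
apply/subsetP=> f; rewrite in_setU1 => /predU1P[-> | fB]; first by rewrite defH' !inE eqxx !orbT.
apply: contraT => fNH'.
have := subsetP lost f; rewrite !inE fNH' (subsetP sBH f fB) => /(_ isT).
by rewrite -orbA => /or3P[] /eqP def_f; rewrite def_f ?(negPf g1NB) ?(negPf g2NB) in fB.
Qed.

(** The edges of [B] at [u] and [v] belong to the arc through [c0]. As [[set u; v]] is admissible,
    it does not close this arc to a cycle, so the arc has an edge outside [B]. The exchange opens
    the arc there and splices the other arc into the gap. *)
Lemma three_exchange H B u v a0 s c0 t :
  uniq (u :: a0 :: s ++ v :: c0 :: t) -> size (u :: a0 :: s ++ v :: c0 :: t) = n ->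
  H = cyc (u :: a0 :: s ++ v :: c0 :: t) -> B \subset H -> [set u; v] \notin H ->
  admissible B [set u; v] ->
  [set u; a0] \notin B -> [set last a0 s; v] \notin B ->
  [set last c0 t; u] \in B -> [set v; c0] \in B -> exchangeable H B [set u; v].
Proof.
move=> Us szs defH sBH eNH admB g1NB g2NB aB bB; rewrite cyc_split in defH.
have [[uv uA uC] [vA vC] AC] := @uniq_split u v (a0 :: s) (c0 :: t) Us.
pose a1 := last a0 s; pose c1 := last c0 t.
have [a1_in c1_in] : a1 \in a0 :: s /\ c1 \in c0 :: t by rewrite !mem_last.
(* With [[set u; v]] the arc through [c0] is a cycle that misses [a0], hence shorter than [n]. *)
have no_arc (C : {set {set 'I_n}}) :
    ~~ has_cycle_lt C -> [set u; v] \in C -> ~~ (pth v (rcons (c0 :: t) u) \subset C).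
  move=> cycC eC; apply: contra cycC => sub; apply: (@has_cycle_lt_list _ v (rcons (c0 :: t) u)).
  - by rewrite size_rcons.
  - by move: szs; rewrite /= size_rcons size_cat /=; clear; lia.
  - have perm_l : perm_eq (v :: rcons (c0 :: t) u ++ a0 :: s) (u :: a0 :: s ++ v :: c0 :: t).
      apply/seq.permP=> p; rewrite -cats1 /= !count_cat /=.
      move: (nat_of_bool (p u)) (nat_of_bool (p v)) (nat_of_bool (p a0)) (nat_of_bool (p c0)); clear=> *; lia.
    by move: Us; rewrite -(perm_uniq perm_l) -cat_cons cat_uniq => /andP[].
  by rewrite cyc_cons last_rcons subUset sub1set eC.
have [|p [q [r [def_t g3NB]]]] := @pth_notsub _ v (rcons (c0 :: t) u) B.
  have/and4P[_ _ _ cycB] := admB; have := no_arc _ cycB (setU11 _ _).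
  by apply: contra => sub; apply: subset_trans sub (subsetU1 _ _).
have lastr : last q r = u by have := congr1 (last u) def_t; rewrite last_rcons last_cat.
have arcE : [set v; c0] |: pth c0 t :|: [set [set c1; u]]
            = pth v p :|: ([set last v p; q] |: pth q r).
  have := congr1 (pth v) def_t; rewrite pth_rcons pth_cat /= => <-.
  by rewrite setUC.
rewrite arcE in defH.
(* The listing starts behind the gap: of the three added edges, [[set a1; q]] closes the tour and
   the other two are the jumps. *)
pose H' := cyc (q :: r ++ v :: p ++ a0 :: s).
have defH' : H' = pth q r :|: ([set u; v] |: (pth v p :|: ([set last v p; a0] |:
                  (pth a0 s :|: [set [set a1; q]])))).
  rewrite /H' cyc_cons last_cat /= last_cat /= pth_cat /= pth_cat /= lastr.
  by apply/setP=> f; rewrite !inE; do ?(case: (_ == _); rewrite /= ?orbT ?orbF //);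
    do ?(case: (_ \in _); rewrite /= ?orbT ?orbF //).
have lost : H :\: H' \subset [set [set u; a0]; [set a1; v]; [set last v p; q]].
  rewrite defH defH'; apply/subsetP=> f; rewrite !inE.
  by do ?(case: (_ == _); rewrite /= ?orbT ?orbF //); do ?(case: (_ \in _); rewrite /= ?orbT ?orbF //).
have sBH' : B \subset H'.
  apply/subsetP=> f fB; apply: contraT => fNH'.
  have := subsetP lost f; rewrite !inE fNH' (subsetP sBH f fB) => /(_ isT).
  by rewrite -orbA => /or3P[] /eqP def_f; rewrite def_f ?(negPf g1NB) ?(negPf g2NB) ?(negPf g3NB) in fB.
have eH' : [set u; v] \in H' by rewrite defH' !inE eqxx !orbT.
exists H', [set u; a0], [set a1; v], [set last v p; q], [set c1; u], [set v; c0]; split; last first.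
  by rewrite subUset sub1set eH'.
split=> //.
- exists q, (r ++ v :: p ++ a0 :: s); split=> //.
  + have perm_l : perm_eq (q :: r ++ v :: p ++ a0 :: s) (u :: a0 :: s ++ v :: c0 :: t).
      apply/seq.permP=> P; have := congr1 (count P) def_t.
      rewrite -cats1 /= !(count_cat, count_rev) /= !(count_cat, count_rev) /=.
      move: (nat_of_bool (P q)).
      move: (nat_of_bool (P u)) (nat_of_bool (P v)) (nat_of_bool (P a0)) (nat_of_bool (P c0)); clear=> *; lia.
    by rewrite (perm_uniq perm_l).
  + have := congr1 size def_t; move: szs.
    by rewrite /= !(size_rcons, size_cat) /= !size_cat /=; clear; lia.
  have sub_r : pth q r \subset H.
    by apply/subsetP=> f fp; rewrite defH !inE fp !orbT.
  have sub_p : pth v p \subset H.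
    by apply/subsetP=> f fp; rewrite defH !inE fp !orbT.
  have sub_s : pth a0 s \subset H.
    by apply/subsetP=> f fp; rewrite defH !inE fp !orbT.
  rewrite jumps_cat /= jumps_cat /= !jumps_sub //.
  by do 2!case: (_ \in _).
- by rewrite inE (subsetP sBH) ?(subsetP sBH').
- by rewrite inE (subsetP sBH) ?(subsetP sBH').
- by rewrite (setUC [set c1]) set2_neq // eq_sym uC ?mem_head.
- move=> C aC eC; apply: (not_admissible_deg aC eC (v := u)); rewrite ?inE ?eqxx ?orbT //.
  by rewrite set2_neq ?uC ?vC.
- move=> C bC eC; apply: (not_admissible_deg bC eC (v := v)); rewrite ?inE ?eqxx ?orbT //.
  by rewrite setUC set2_neq ?uC ?vC ?mem_head.
(* All edges of the arc except [g3] are common to both tours, so adding [g3] would complete the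
   short cycle. *)
apply/negP=> /and4P[_ _ _ /no_arc arcN].
have /arcN/negP[] : [set u; v] \in [set last v p; q] |: ([set u; v] |: H :&: H').
  by rewrite !inE eqxx !orbT.
rewrite def_t pth_cat /= !subUset sub1set !inE eqxx /=.
by apply/andP; split; apply/subsetP=> f fp; rewrite defH defH' !inE fp !orbT.
Qed.

(** By admissibility [B] holds at most one tour edge at [u] and at most one at [v]. If it misses the
    two edges following [u] and [v], or the two preceding them, a 2-exchange applies. Otherwise it
    holds both end edges of one arc and misses those of the other, and a 3-exchange applies. *)
Lemma exchange_exists H B e :
  is_ham H -> B \subset H -> admissible B e -> e \notin H -> exchangeable H B e.
Proof.
move=> hamH sBH admB; have /and4P[/cards2P[u [v [uv def_e]]] _ _ _] := admB.
rewrite {}def_e in admB * => eNH.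
have [s0 [Us szs defH]] := ham_start u hamH.
have : v \in u :: s0 by apply: uniq_full.
rewrite inE eq_sym (negPf uv) /= => v_in.
case/splitPr: v_in => A C in Us szs defH *.
case: A => [|a0 s] in Us szs defH *.
  by case/negP: eNH; rewrite defH cyc_cons /= !inE eqxx !orbT.
case: C => [|c0 t] in Us szs defH *.
  by case/negP: eNH; rewrite defH cyc_cons last_cat /= setUC !inE eqxx.
rewrite cat_cons in Us szs defH.
have [[_ uA uC] [vA vC] AC] := @uniq_split u v (a0 :: s) (c0 :: t) Us.
have degu : ~~ (([set u; a0] \in B) && ([set last c0 t; u] \in B)).
  apply: contraL admB => /andP[uaB ucB].
  apply: (not_admissible_deg uaB ucB (v := u)); rewrite ?inE ?eqxx ?orbT //.
  by rewrite setUC set2_neq ?uA ?mem_head // AC ?mem_head ?mem_last.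
have degv : ~~ (([set v; c0] \in B) && ([set last a0 s; v] \in B)).
  apply: contraL admB => /andP[uaB ucB].
  apply: (not_admissible_deg uaB ucB (v := v)); rewrite ?inE ?eqxx ?orbT //.
  by rewrite setUC set2_neq ?vC ?mem_head // eq_sym AC ?mem_head ?mem_last.
have [/andP[uaN vcN] | not1] := boolP (([set u; a0] \notin B) && ([set v; c0] \notin B)).
  exact: two_exchange defH _ _ _ _.
have [/andP[ucN vaN] | not2] :=
    boolP (([set last c0 t; u] \notin B) && ([set last a0 s; v] \notin B)).
  (* The tour read backwards turns the preceding edges into following ones. *)
  have defH2 : H = cyc (u :: last c0 t :: rev (belast c0 t) ++ v :: last a0 s :: rev (belast a0 s)).
    rewrite -[_ :: rev _ ++ _]cat_cons -!rev_lastI -(cat1s u) cyc_catC -cyc_rev.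
    by rewrite rev_cat rev_cat (rev_cons v) !revK cat_rcons defH.
  have perm_l : perm_eq (u :: last c0 t :: rev (belast c0 t) ++ v :: last a0 s :: rev (belast a0 s))
                        (u :: a0 :: s ++ v :: c0 :: t).
    rewrite -[_ :: rev _ ++ _]cat_cons -!rev_lastI; apply/seq.permP=> P.
    rewrite /= !(count_cat, count_rev) /= !count_rev /=.
    move: (nat_of_bool (P u)) (nat_of_bool (P v)) (nat_of_bool (P a0)) (nat_of_bool (P c0)); clear=> *; lia.
  apply: two_exchange defH2 _ _ _ _ => //.
  + by rewrite (perm_uniq perm_l).
  + by rewrite (perm_size perm_l).
  + by rewrite setUC.
  + by rewrite setUC.
have [uaB | uaN] := boolP ([set u; a0] \in B).
  have ucN : [set last c0 t; u] \notin B by move: degu; rewrite uaB.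
  have vaB : [set last a0 s; v] \in B by move: not2; rewrite ucN negbK.
  have vcN : [set v; c0] \notin B by move: degv; rewrite vaB andbT.
  (* Rotating the tour exchanges the roles of [u] and [v], and thereby of the two arcs. *)
  have defH2 : H = cyc (v :: c0 :: t ++ u :: a0 :: s).
    by rewrite -!cat_cons -cyc_catC.
  have perm_l : perm_eq (v :: c0 :: t ++ u :: a0 :: s) (u :: a0 :: s ++ v :: c0 :: t).
    by rewrite -!cat_cons perm_catC.
  rewrite setUC in eNH admB *.
  apply: three_exchange defH2 _ _ _ _ _ _ _ => //; first by rewrite (perm_uniq perm_l).
  by rewrite (perm_size perm_l).
have vcB : [set v; c0] \in B by move: not1; rewrite uaN negbK.
have vaN : [set last a0 s; v] \notin B by move: degv; rewrite vcB.
have ucB : [set last c0 t; u] \in B by move: not2; rewrite vaN andbT negbK.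
exact: three_exchange defH _ _ _ _ _ _ _.
Qed.

(** The edge-based process never gets stuck: its partial edge set always lies in some tour. *)
Lemma admissible_extend H B e : is_ham H -> B \subset H -> admissible B e ->
  exists2 H', is_ham H' & e |: B \subset H'.
Proof.
move=> hamH sBH admB; have [eH | eNH] := boolP (e \in H).
  by exists H; rewrite // subUset sub1set eH.
have [H' [g1 [g2 [g3 [a [b [[[x [l [Ul szl defH' _]]] _ _ _ _ _ _ _ _] sub]]]]]]] :=
  exchange_exists hamH sBH admB eNH.
by exists H' => //; apply/ham_listP; exists (x :: l).
Qed.

End Exchange.

(** * Counting, costs *)

Section Counting.
Variable n : nat.
Hypothesis n_gt3 : 3 < n.
Implicit Types (u v x : 'I_n) (e : {set 'I_n}) (B H : {set {set 'I_n}}).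

Let n_gt1 : 1 < n. Proof. by lia. Qed.
Let n_gt2 : 2 < n. Proof. by lia. Qed.

Lemma sum_deg H B : is_ham H -> B \subset H -> \sum_v #|edges_at B v| = #|B|.*2.
Proof.
move=> hamH /subsetP sBH.
transitivity (\sum_(e in B) #|e|).
  rewrite (eq_bigr (fun v => \sum_(e in B) (v \in e : nat))); last first.
    move=> v _; rewrite -sum1_card big_mkcond [RHS]big_mkcond; apply: eq_bigr => e _.
    by rewrite inE; case: (e \in B); case: (v \in e).
  rewrite exchange_big; apply: eq_bigr => e _.
  by rewrite -sum1_card [RHS]big_mkcond.
rewrite (eq_bigr (fun=> 2)); first by rewrite sum_nat_const muln2.
by move=> e /sBH; apply: ham_edge2.
Qed.

(* Admissible edges join vertices of degree less than 2, of which there are at most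
   [2 * (n - #|B|)]. *)
Lemma card_admissible H B : is_ham H -> B \subset H ->
  #|[set e | admissible B e]| <= 2 * (n - #|B|) ^ 2.
Proof.
move=> hamH sBH; pose D := [set v | #|edges_at B v| < 2].
have deg2 v : #|edges_at B v| <= 2.
  exact: leq_trans (subset_leq_card (edges_at_subset _ sBH)) (ham_deg v hamH).
(* The deficits [2 - #|edges_at B v|] add up to [2 * (n - #|B|)], and each vertex of [D] contributes
   at least 1. *)
have cardD : #|D| <= 2 * (n - #|B|).
  have : \sum_v (#|edges_at B v| + (v \in D)) <= \sum_(v : 'I_n) 2.
    by apply: leq_sum => v _; rewrite inE; have := deg2 v; lia.
  rewrite big_split /= (sum_deg hamH sBH) sum_nat_const card_ord -big_mkcond sum1_card.
  by rewrite -mul2n; move: #|D| #|B|; clear=> d b; lia.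
have sub : [set e | admissible B e] \subset [set A : {set 'I_n} | A \subset D & #|A| == 2].
  apply/subsetP=> e; rewrite !inE => /and4P[-> eNB /forallP deg _]; rewrite andbT.
  apply/subsetP=> v ve; rewrite inE; apply: leq_trans (deg v).
  have -> : [set x in e |: B | v \in x] = e |: edges_at B v.
    by apply/setP=> x; rewrite !inE andb_orl; case: eqP => // ->; rewrite ve.
  by rewrite cardsU1 inE (negPf eNB).
apply: leq_trans (subset_leq_card sub) _; rewrite cards_draws bin2.
rewrite leq_half_double (leq_trans (leq_mul cardD (leq_trans (leq_pred _) cardD))) //.
by clear; rewrite -muln2; nia.
Qed.

Definition star : {set {set 'I_n}} := cyc_edges 1%g.

Lemma ham_star : is_ham star. Proof. by apply/existsP; exists 1%g. Qed.

Lemma mem_star e : (e \in star) = [exists i : 'I_n, e == [set i; ordS i]].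
Proof.
apply/imsetP/existsP => [[i _ ->] | [i /eqP ->]]; exists i => //; by rewrite !perm1.
Qed.

(** Taken with [B = H :&: star]: a missing optimal edge is admissible because everything stays
    inside [star], and the exchange gains it without losing an optimal edge. *)
Lemma exchange_star H : is_ham H -> H != star ->
  exists e H' g1 g2 g3 a b,
    [/\ e \notin H, exchange H e H' g1 g2 g3 a b & #|H :&: star| < #|H' :&: star|].
Proof.
move=> hamH neqH.
have [e e_star eNH] : exists2 e, e \in star & e \notin H.
  apply/subsetPn; apply: contra neqH => sub; rewrite eq_sym eqEcard sub.
  by rewrite /= !(card_ham n_gt2) // ham_star.
have adm : admissible (H :&: star) e.
  apply: (admissible_ham n_gt1 ham_star); last by rewrite inE (negPf eNH).
  by rewrite subUset sub1set e_star subsetIr.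
have [H' [g1 [g2 [g3 [a [b [ex sub]]]]]]] := exchange_exists hamH (subsetIl _ _) adm eNH.
exists e, H', g1, g2, g3, a, b; split=> //.
have: #|e |: H :&: star| <= #|H' :&: star|.
  by apply: subset_leq_card; rewrite subsetI sub subUset sub1set e_star subsetIr.
by rewrite cardsU1 inE (negPf eNH).
Qed.

Section Cost.
Variable R : realType.
Local Open Scope ring_scope.

Lemma costE H : is_ham H ->
  cost R H = (n * n)%:R - (n.-1)%:R * #|H :&: star|%:R.
Proof.
move=> hamH; have cardH := card_ham n_gt2 hamH.
rewrite /cost (big_setID star) /= (eq_bigr (fun=> 1)); last first.
  by move=> e /setIP[_]; rewrite mem_star /distG1 => ->.
rewrite [X in _ + X](eq_bigr (fun=> n%:R)); last first.
  by move=> e /setDP[_]; rewrite mem_star /distG1 => /negPf->.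
rewrite !sumr_const -mulr_natr mul1r.
have := cardsID star H; rewrite cardH => /(congr1 (fun k => k%:R : R)).
have -> : n.-1%:R = n%:R - 1 :> R by rewrite -subn1 natrB // ltnW.
rewrite -mulr_natr natrD natrM => <-; ring.
Qed.

Lemma cost_le_star H1 H2 : is_ham H1 -> is_ham H2 ->
  (cost R H1 <= cost R H2) = (#|H2 :&: star| <= #|H1 :&: star|)%N.
Proof.
move=> ham1 ham2; rewrite !costE // lerD2l lerN2 ler_pM2l ?ler_nat //.
by rewrite ltr0n; move: n_gt1; clear; lia.
Qed.

Lemma star_optimal : is_optimal R star.
Proof.
rewrite /is_optimal ham_star; apply/forallP=> H; apply/implyP=> hamH.
rewrite cost_le_star ?ham_star // setIid.
by rewrite subset_leq_card // subsetIr.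
Qed.

End Cost.
End Counting.

(** * The iterated process *)

Local Open Scope ring_scope.

Section Process.
Variables (R : realType) (n N : nat).
Hypothesis n_gt3 : (3 < n)%N.
Variable gen : ('I_n -> 'I_n -> R) -> {set {set 'I_n}} -> R.
Implicit Types (P : 'I_n -> 'I_n -> R) (H : {set {set 'I_n}}).

(** What both generators have to satisfy. As [gen] is defined on arbitrary edge sets, the last field
    confines its mass to tours. *)
Record ham_distr P : Prop := HamDistr {
  distr_ge0 : forall H, 0 <= gen P H;
  distr_sum : \sum_H gen P H = 1;
  distr_ham : forall H, gen P H != 0 -> is_ham H }.

Variable sel : selector n N.
Hypothesis valid_sel : valid_selector R sel.

Lemma sample_ge0 P (X : {ffun 'I_N -> {set {set 'I_n}}}) : ham_distr P -> 0 <= sample_prob gen P X.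
Proof. by move=> dP; apply: prodr_ge0 => j _; apply: distr_ge0. Qed.

(** Independence of the samples: a power of a sum expands into a sum over families. *)
Lemma sum_sample (p : pred {set {set 'I_n}}) P :
  \sum_(X : {ffun 'I_N -> {set {set 'I_n}}} | [forall j, p (X j)]) sample_prob gen P X
  = (\sum_(H | p H) gen P H) ^+ N.
Proof.
rewrite -[in RHS](card_ord N) -prodr_const bigA_distr_big /=.
by apply: eq_bigl => X; apply/forallP/ffun_onP.
Qed.

Lemma sum_sample_true P : ham_distr P ->
  \sum_(X : {ffun 'I_N -> {set {set 'I_n}}}) sample_prob gen P X = 1.
Proof.
move=> dP; have := sum_sample predT P; rewrite (distr_sum dP) expr1n => <-.
by apply: eq_bigl => X; apply/esym/forallP.
Qed.

Lemma sample_ham P (X : {ffun 'I_N -> {set {set 'I_n}}}) :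
  sample_prob gen P X != 0 -> ham_distr P -> forall j, is_ham (X j).
Proof.
by move=> /prodf_neq0 XP dP j; apply: (distr_ham dP); apply: XP.
Qed.

Hypothesis distr0 : ham_distr (@Pi0 R n).
Hypothesis distrH : forall H, is_ham H -> ham_distr (Pi_of R H).

Lemma succ_prob_ge0 k t P : ham_distr P -> 0 <= succ_prob gen sel k t P.
Proof.
elim: k t P => [|k IHk] t P dP; apply: sumr_ge0 => X _.
  by rewrite mulr_ge0 ?sample_ge0 //; case: ifP.
have [->|XP] := eqVneq (sample_prob gen P X) 0; first by rewrite mul0r.
rewrite mulr_ge0 ?sample_ge0 //; case: ifP => // _; apply: IHk; apply: distrH.
exact: sample_ham XP dP _.
Qed.

Variable p : R.
Hypothesis p_le1 : p <= 1.
Hypothesis p_le : forall H, is_ham H -> H != star n ->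
  exists2 H', (#|H :&: star n| < #|H' :&: star n|)%N & p <= gen (Pi_of R H) H'.

(** Bounds the probability that none of the [N] samples is closer to the optimum than the current
    tour. *)
Let q := (1 - p) ^+ N.

Definition closer H H' := (#|H :&: star n| < #|H' :&: star n|)%N.

Lemma sample_closer H : is_ham H -> H != star n ->
  1 - q <= \sum_(X : {ffun 'I_N -> {set {set 'I_n}}} | [exists j, closer H (X j)])
             sample_prob gen (Pi_of R H) X.
Proof.
move=> hamH neqH; have dH := distrH hamH; have [H' clH' pH'] := p_le hamH neqH.
have := sum_sample_true dH.
rewrite (bigID (fun X : {ffun _} => [exists j, closer H (X j)])) /=.
have -> : \sum_(X : {ffun 'I_N -> {set {set 'I_n}}} | ~~ [exists j, closer H (X j)])
            sample_prob gen (Pi_of R H) X = (\sum_(H0 | ~~ closer H H0) gen (Pi_of R H) H0) ^+ N.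
  by rewrite -sum_sample; apply: eq_bigl => X; rewrite negb_exists.
move=> <-; rewrite lerBlDr lerD2l /q.
have sum_cl : \sum_(H0 | closer H H0) gen (Pi_of R H) H0
              + \sum_(H0 | ~~ closer H H0) gen (Pi_of R H) H0 = 1.
  by rewrite -(distr_sum dH) [RHS](bigID (closer H)).
rewrite lerXn2r ?nnegrE ?subr_ge0 //; first by apply: sumr_ge0 => *; apply: distr_ge0.
rewrite lerBrDl -sum_cl lerD2r; apply: le_trans pH' _.
rewrite (bigD1 H') //= lerDl.
by apply: sumr_ge0 => *; apply: distr_ge0.
Qed.

Lemma q_ge0 : 0 <= q. Proof. by rewrite exprn_ge0 // subr_ge0. Qed.

Lemma not_optimal H : ~~ is_optimal R H -> H != star n.
Proof. by apply: contraNneq => ->; apply: star_optimal. Qed.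

Lemma star_lt H : is_ham H -> H != star n -> (#|H :&: star n| < n)%N.
Proof.
move=> hamH; have n_gt2 : (2 < n)%N by move: n_gt3; clear; lia.
rewrite -[X in (_ < X)%N](card_ham n_gt2 hamH) ltnNge; apply: contra => le_card.
have sub : H \subset star n by apply/setIidPl/eqP; rewrite eqEcard subsetIl.
by rewrite eqEcard sub /= !(card_ham n_gt2) // ham_star.
Qed.

(* Per iteration, a failure to come closer to the optimum costs at most [q]. *)
Lemma succ_prob_ham k t H : is_ham H -> H != star n -> (n - #|H :&: star n| <= k.+1)%N ->
  1 - q *+ k.+1 <= succ_prob gen sel k t (Pi_of R H).
Proof.
elim: k t H => [|k IHk] t H hamH neqH le_k; have dH := distrH hamH;
  have q0 := q_ge0; have := sample_closer hamH neqH; rewrite big_mkcond /=.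
all: set G := (X in _ <= X -> _) => leG.
  rewrite mulr1n (le_trans leG) // /G; apply: ler_sum => X _.
  have [->|XP] := eqVneq (sample_prob gen (Pi_of R H) X) 0; first by rewrite mul0r; case: ifP.
  have hamX := sample_ham XP dH.
  have X0 := sample_ge0 X dH.
  case: ifP => [/existsP[j clj] | _]; last by rewrite mulr_ge0 //; case: ifP.
  case: ifPn => [_ | /not_optimal neqX]; first by rewrite mulr1.
  (* At most one optimal edge is missing here, so a closer sample has them all, and so has the
     selected one, being no more expensive. *)
  have := star_lt (hamX _) neqX; have := valid_sel t X j; rewrite cost_le_star // => le1 lt2.
  by move: clj; rewrite /closer; move: le1 lt2 le_k; clear; lia.
(* This iteration pays one [q]; the other [k.+1] are for the induction hypothesis. *)
suff: G - q *+ k.+1 <= succ_prob gen sel k.+1 t (Pi_of R H).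
  by apply: le_trans; rewrite mulrS opprD addrA lerD2r.
have -> : q *+ k.+1 = \sum_(X : {ffun 'I_N -> {set {set 'I_n}}}) sample_prob gen (Pi_of R H) X * (q *+ k.+1).
  by rewrite -mulr_suml sum_sample_true // mul1r.
have qk0 : 0 <= q *+ k.+1 by rewrite mulrn_wge0.
rewrite /G -sumrB /=; apply: ler_sum => X _.
have [->|XP] := eqVneq (sample_prob gen (Pi_of R H) X) 0.
  by rewrite !mul0r subr0; case: ifP.
have hamX := sample_ham XP dH.
have X0 := sample_ge0 X dH.
case: ifP => [/existsP[j clj] | _]; last first.
  rewrite (@le_trans _ _ 0) ?sub0r ?oppr_le0 ?mulr_ge0 //.
  by case: ifP => // _; apply: succ_prob_ge0; apply: distrH.
rewrite -{1}[sample_prob _ _ _]mulr1 -mulrBr ler_wpM2l //.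
case: ifPn => [_ | /not_optimal neqX]; first by rewrite gerBl.
apply: IHk => //.
have := star_lt (hamX _) neqX; have := valid_sel t X j; rewrite cost_le_star // => le1 lt2.
by move: clj; rewrite /closer; move: le1 lt2 le_k; clear; lia.
Qed.

(** The iteration from [Pi0] only has to yield some tour, and each of the [k.+1] later ones gains an
    optimal edge. For [k.+1 = n] these are the iterations [0] to [n]. *)
Lemma succ_prob_init k t : (n <= k.+1)%N ->
  1 - q *+ k.+1 <= succ_prob gen sel k.+1 t (@Pi0 R n).
Proof.
move=> le_k; set r := 1 - _.
have -> : r = \sum_(X : {ffun 'I_N -> {set {set 'I_n}}}) sample_prob gen (@Pi0 R n) X * r.
  by rewrite -mulr_suml sum_sample_true // mul1r.
apply: ler_sum => X _; have [->|XP] := eqVneq (sample_prob gen (@Pi0 R n) X) 0; first by rewrite !mul0r.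
rewrite ler_wpM2l ?sample_ge0 //; case: ifPn => [_ | /not_optimal neqX].
  by rewrite gerBl mulrn_wge0 ?q_ge0.
apply: succ_prob_ham neqX _; first exact: sample_ham XP distr0 _.
by rewrite (leq_trans (leq_subr _ _)).
Qed.

Lemma prob_found_ge : 1 - q *+ n <= prob_found_within gen sel n.
Proof.
have def_n : n = n.-1.+1 by move: n_gt3; clear; lia.
rewrite /prob_found_within [X in succ_prob _ _ X]def_n [X in q *+ X]def_n.
by apply: succ_prob_init; rewrite -def_n.
Qed.

End Process.

(** * Vertex-based generation *)

Section Weights.
Variables (R : realType) (n : nat).
Hypothesis n_gt3 : (3 < n)%N.
Implicit Types (u v w : 'I_n) (H : {set {set 'I_n}}).

Definition positive_weights (P : 'I_n -> 'I_n -> R) :=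
  (forall u v, 0 <= P u v) /\ (forall u v, u != v -> 0 < P u v).

Lemma pi_minE : pi_min R n = (n%:R * (n%:R - 2))^-1.
Proof. by rewrite /pi_min natrM natrB // -ltnS ltnW // ltnW. Qed.

Lemma n_ge4 : 4 <= n%:R :> R. Proof. by rewrite (ler_nat R 4 n). Qed.

Lemma pi_min_gt0 : 0 < pi_min R n.
Proof. by have n4 := n_ge4; rewrite pi_minE invr_gt0 mulr_gt0; lra. Qed.

Lemma pi_max_ge : 3 / 4 <= pi_max R n.
Proof.
have n4 := n_ge4; rewrite /pi_max.
have : (n%:R : R)^-1 <= 4^-1 by rewrite lef_pV2 ?posrE; lra.
lra.
Qed.

Lemma pi_max_gt0 : 0 < pi_max R n. Proof. by have := pi_max_ge; lra. Qed.

Lemma pi_max_lt1 : pi_max R n <= 1.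
Proof. by rewrite /pi_max gerBl invr_ge0 ler0n. Qed.

Lemma Pi0_pos : positive_weights (@Pi0 R n).
Proof.
have n1 : 0 < (n.-1%:R : R)^-1 by rewrite invr_gt0 ltr0n; move: n_gt3; clear; lia.
by split=> u v; rewrite /Pi0; case: eqP => // _; rewrite ltW.
Qed.

Lemma Pi_of_pos H : positive_weights (Pi_of R H).
Proof.
have m0 := pi_min_gt0; have M0 := pi_max_gt0.
by split=> u v; rewrite /Pi_of; case: eqP => // _; case: ifP => _ //; rewrite ltW.
Qed.

End Weights.

Section Vertex.
Variables (R : realType) (n : nat).
Hypothesis n_gt3 : (3 < n)%N.
Implicit Types (u v w x : 'I_n) (s t : seq 'I_n) (H : {set {set 'I_n}}).
Implicit Types (P : 'I_n -> 'I_n -> R).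

Lemma sum_gt0 P v s : positive_weights P -> v \notin s -> s != [::] -> 0 < \sum_(u <- s) P v u.
Proof.
case=> _ P_gt0; case: s => // w s; rewrite inE negb_or big_cons => /andP[vw vs] _.
rewrite ltr_wpDr ?P_gt0 //; elim: s vs => [|u s IHs]; rewrite ?big_nil // big_cons inE negb_or.
by case/andP=> vu /IHs; apply: addr_ge0; rewrite ltW ?P_gt0.
Qed.

Lemma path_prob_ge0 P v s : positive_weights P -> 0 <= path_prob P v s.
Proof.
move=> [P_ge0 _]; elim: s v => [|w s IHs] v //=.
by rewrite mulr_ge0 // divr_ge0 // sumr_ge0.
Qed.

Lemma order_prob_ge0 P (s : {perm 'I_n}) : positive_weights P -> 0 <= order_prob P s.
Proof.
move=> P0; rewrite /order_prob; case: (map _ _) => // v t.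
by rewrite mulr_ge0 ?invr_ge0 ?ler0n ?path_prob_ge0.
Qed.

(** Grouped by their first vertex, the continuations have total probability 1 by induction, and the
    first steps are normalised. *)
Lemma sum_path_prob P v s : positive_weights P -> v \notin s -> uniq s ->
  \sum_(t <- permutations s) path_prob P v t = 1.
Proof.
move=> P0; have [k] := ubnP (size s); elim: k s v => // k IHk s v lt_k vs Us.
have [->|s0] := eqVneq s [::]; first by rewrite big_seq1.
rewrite (perm_big _ (permutationsE _)) /=; last by rewrite lt0n size_eq0.
rewrite big_allpairs_dep /= undup_id // big_seq.
transitivity (\sum_(x <- s | x \in s) P v x / \sum_(u <- s) P v u).
  apply: eq_bigr => x xs.
  rewrite -[RHS]mulr1 -(IHk (rem x s) x); first last.
  - exact: rem_uniq.
  - by rewrite mem_rem_uniq // !inE eqxx.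
  - rewrite size_rem //; move: lt_k; case: (s) xs => //.
  rewrite mulr_sumr big_seq [RHS]big_seq; apply: eq_bigr => t.
  rewrite mem_permutations => perm_t; congr (_ / _ * _); apply: perm_big.
  by rewrite perm_sym (permPl (perm_to_rem xs)) perm_cons perm_sym.
by rewrite -big_seq -mulr_suml divff // gt_eqF ?sum_gt0.
Qed.

Lemma sum_order_prob P : positive_weights P -> \sum_(s : {perm 'I_n}) order_prob P s = 1.
Proof.
move=> P0; pose F (t : seq 'I_n) : R := if t is v :: r then n%:R^-1 * path_prob P v r else 0.
transitivity (\sum_(t <- permutations (enum 'I_n)) F t).
  rewrite -(big_map (fun s : {perm 'I_n} => [seq s i | i <- enum 'I_n]) xpredT F) /=.
  apply: perm_big; apply: uniq_perm; rewrite ?permutations_uniq //.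
    rewrite map_inj_uniq ?index_enum_uniq // => s1 s2 eq_s; apply/permP=> i.
    by move/eq_in_map: eq_s => ->; rewrite ?mem_enum.
  move=> t; rewrite mem_permutations; apply/mapP/idP => [[s _ ->] | perm_t].
    apply: uniq_perm; rewrite ?enum_uniq ?listing_uniq // => i.
    by rewrite mem_enum uniq_full ?listing_uniq ?size_listing.
  have [||s <-] := @listingP n t; last by exists s; rewrite ?mem_index_enum.
    by rewrite (perm_uniq perm_t) enum_uniq.
  by rewrite (perm_size perm_t) size_enum_ord.
have enum0 : (0 < size (enum 'I_n))%N by rewrite size_enum_ord; move: n_gt3; clear; lia.
rewrite (perm_big _ (permutationsE enum0)) /= big_allpairs_dep /= undup_id ?enum_uniq //.
rewrite (eq_bigr (fun=> n%:R^-1)) => [|x _]; last first.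
  rewrite /= -mulr_sumr sum_path_prob ?mulr1 ?rem_uniq ?enum_uniq //.
  by rewrite mem_rem_uniq ?enum_uniq // !inE eqxx.
rewrite big_const_seq count_predT size_enum_ord iter_addr_0 -[_ *+ _]mulr_natr mulVf // pnatr_eq0.
by move: n_gt3; clear; lia.
Qed.

Lemma vgen_distr P : positive_weights P -> ham_distr (@vgen R n) P.
Proof.
move=> P0; split=> [H | | H].
- by apply: sumr_ge0 => s _; apply: order_prob_ge0.
- rewrite -(sum_order_prob P0) [RHS](partition_big (@cyc_edges n) xpredT) //=.
- apply: contraNT => /existsPn hamN; rewrite /vgen big1 // => s /eqP def_H.
  by have := hamN s; rewrite def_H eqxx.
Qed.

(** [S] is the weight of the unvisited vertices, [F] the probability of the remaining walk and [A] a
    lower bound for it. A step along [H] keeps the factor [M] if [S <= 1], and otherwise loses at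
    most a further factor 4. *)
Lemma kept_step (M S A F : R) : 3 / 4 <= M -> 0 < S -> S <= 2 -> 0 <= A -> A <= F ->
  (S <= 1 -> M * A <= M / S * F) /\ 1 / 4 * (M * A) <= M / S * F.
Proof.
move=> M34 S0 S2 A0 AF.
have MF : 0 <= M * F by rewrite mulr_ge0; lra.
have MA : 0 <= M * A by rewrite mulr_ge0; lra.
have MAF : M * A <= M * F by rewrite ler_wpM2l; lra.
rewrite mulrAC; split=> [S1|]; rewrite ler_pdivlMr //.
  have : M * A * S <= M * A * 1 by rewrite ler_wpM2l.
  lra.
have : M * A * S <= M * A * 2 by rewrite ler_wpM2l.
lra.
Qed.

(** The 8 is 2 for the weight [S] times 4 for the weaker bound on a walk that follows a jump. *)
Lemma new_step (M m S A F : R) : 3 / 4 <= M -> M <= 1 -> 0 < m -> 0 < S -> S <= 2 -> 0 <= A ->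
  1 / 4 * A <= F -> M * A * (m / 8) <= m / S * F.
Proof.
move=> M34 M1 m0 S0 S2 A0 AF; rewrite (mulrAC m) ler_pdivlMr //.
have MA0 : 0 <= M * A by rewrite mulr_ge0; lra.
have MA1 : M * A <= A by rewrite ler_piMl.
have : m * (1 / 4 * A) <= m * F by rewrite ler_wpM2l // ltW.
have : m * (M * A) <= m * A by rewrite ler_wpM2l // ltW.
have : m * (M * A) * S <= m * (M * A) * 2 by rewrite ler_wpM2l // mulr_ge0 // ltW.
lra.
Qed.

Section Step.
Variable H : {set {set 'I_n}}.
Hypothesis hamH : is_ham H.

Lemma count_nbr_le s v : uniq s -> (count (fun u => [set v; u] \in H) s <= 2)%N.
Proof.
move=> Us; apply: leq_trans (ham_deg v hamH).
rewrite -size_filter -(card_uniqP (filter_uniq _ Us)).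
rewrite -(card_imset (mem (filter _ s)) (f := fun u => [set v; u])); last by move=> x y /set2_injl.
apply: subset_leq_card; apply/subsetP=> e /imsetP[u].
by rewrite inE mem_filter => /andP[vuH us] ->; rewrite !inE vuH eqxx.
Qed.

Local Notation m := (pi_min R n).
Local Notation M := (pi_max R n).

Lemma weight_sum_le s v : v \notin s ->
  \sum_(u <- s) Pi_of R H v u
    <= (size s)%:R * m + (count (fun u => [set v; u] \in H) s)%:R * (M - m).
Proof.
elim: s => [|u s IHs] /=; first by rewrite big_nil !mul0r addr0.
rewrite inE negb_or => /andP[vu vs]; rewrite big_cons.
have := IHs vs; rewrite [Pi_of _ _ _ u]/Pi_of ifN //.
rewrite -[(size s).+1]addn1 !natrD !mulrDl .
by case: ifP => _ /=; lra.
Qed.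

(** Equivalently, one entry [M] and [n - 2] entries [m] add up to 1. *)
Lemma pi_min_mul : (n.-2)%:R * m = n%:R^-1.
Proof.
have n4 := n_ge4 R n_gt3; rewrite pi_minE // invfM mulrCA -subn2 natrB ?mulfV ?mulr1 //.
- by rewrite gt_eqF //; lra.
- by move: n_gt3; clear; lia.
Qed.

Lemma pi_min_max : [/\ 0 < m, 2 * m <= n%:R^-1, M = 1 - n%:R^-1 & n%:R^-1 <= 1 / 4 :> R].
Proof.
have m0 := pi_min_gt0 R n_gt3; split=> //; last by have := pi_max_ge R n_gt3; rewrite /pi_max; lra.
by rewrite -pi_min_mul ler_wpM2r ?(ltW m0) // (ler_nat R 2); move: n_gt3; clear; lia.
Qed.

Lemma uniq_size s : uniq s -> (size s <= n)%N.
Proof. by move=> Us; rewrite -[n in leqRHS]card_ord -(card_uniqP Us) max_card. Qed.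

Lemma weight_sum_le_size s v (k c : nat) : v \notin s -> (size s <= k)%N ->
  (count (fun u => [set v; u] \in H) s <= c)%N ->
  \sum_(u <- s) Pi_of R H v u <= k%:R * m + c%:R * (M - m).
Proof.
move=> vs le_k le_c; have [m0 m1 defM n4] := pi_min_max.
apply: le_trans (weight_sum_le vs) _; rewrite lerD // ler_wpM2r ?ler_nat ?(ltW m0) //.
by rewrite subr_ge0 defM; lra.
Qed.

(** If [v] is entered from [x] along [H], only one tour neighbour of [v] can still be unvisited. *)
Lemma weight_sum_le1 s v x : uniq [:: x, v & s] -> [set v; x] \in H ->
  \sum_(u <- s) Pi_of R H v u <= 1.
Proof.
move=> Us vxH; have := Us; rewrite /= inE negb_or => /and3P[/andP[xv xs] vs Us'].
have cnt : (count (fun u => [set v; u] \in H) s <= 1)%N.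
  by have /= := @count_nbr_le (x :: s) v; rewrite xs Us' vxH; apply.
have sz : (size s <= n.-2)%N by have /= := uniq_size Us; move: n_gt3; clear; lia.
apply: le_trans (weight_sum_le_size vs sz cnt) _.
by have [m0 m1 defM n4] := pi_min_max; rewrite pi_min_mul; lra.
Qed.

Lemma weight_sum_le2 s v : uniq (v :: s) -> \sum_(u <- s) Pi_of R H v u <= 2.
Proof.
move=> Us; have /= /andP[vs Us'] := Us.
have sz : (size s <= n.-2 + 1)%N by have /= := uniq_size Us; move: n_gt3; clear; lia.
apply: le_trans (weight_sum_le_size vs sz (count_nbr_le v Us')) _.
have [m0 m1 defM n4] := pi_min_max; rewrite natrD mulrDl pi_min_mul; lra.
Qed.

(** The first bound is for a walk that enters [v] along [H]; at the start or after a jump both tour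
    neighbours may be unvisited, which costs the factor [1 / 4]. The induction uses the first bound
    for the rest after a step along [H] and the second one after a jump. *)
Lemma path_prob_ge v s : uniq (v :: s) ->
  [/\ forall x, x \notin v :: s -> [set v; x] \in H ->
        M ^+ size s * (m / 8) ^+ jumps H v s <= path_prob (Pi_of R H) v s
   & 1 / 4 * M ^+ size s * (m / 8) ^+ jumps H v s <= path_prob (Pi_of R H) v s].
Proof.
have P0 := Pi_of_pos R n_gt3 H; have m0 := pi_min_gt0 R n_gt3.
have M34 := pi_max_ge R n_gt3; have M1 := pi_max_lt1 R n.
have M0 : 0 <= M by lra.
have m8 : 0 <= m / 8 by lra.
have c1 : 1 / 4 <= 1 :> R by lra.
elim: s v => [|w s IHs] v Us; first by rewrite /= !mulr1; split=> //; lra.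
have /= /andP[vs Us'] := Us; have [IH1 IH2] := IHs w Us'.
have vw : v != w by move: vs; rewrite inE; case: eqP.
set S := \sum_(u <- _) _.
have S0 : 0 < S by apply: sum_gt0.
have S2 : S <= 2 by exact: weight_sum_le2.
have A0 : 0 <= M ^+ size s * (m / 8) ^+ jumps H w s by rewrite mulr_ge0 ?exprn_ge0.
have pE : Pi_of R H v w = if [set v; w] \in H then M else m by rewrite /Pi_of (negPf vw).
rewrite pE exprS exprD; case: ifP => vwH /=; rewrite ?expr0 ?expr1 ?[1 * _ ^+ _]mul1r.
  rewrite -[1 / 4 * _ * _]mulrA -[M * _ ^+ _ * _]mulrA.
  have [||step1 step2] := kept_step M34 S0 S2 A0 (IH1 v _ _) => //.
    by rewrite setUC.
  by split=> [x xN vxH|//]; rewrite step1 // (weight_sum_le1 (x := x)) //= xN.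
rewrite -[1 / 4 * _ * _]mulrA in IH2.
have step := new_step M34 M1 m0 S0 S2 A0 IH2.
have Q0 := mulr_ge0 (mulr_ge0 M0 A0) m8.
have E (x y z t : R) : x * y * (z * t) = x * (y * t) * z by ring.
rewrite -[1 / 4 * _ * _]mulrA E; split=> [x _ _ //|].
by apply: le_trans step; rewrite ler_piMl.
Qed.

End Step.

Lemma vgen_exchange H e H' g1 g2 g3 a b : is_ham H -> exchange H e H' g1 g2 g3 a b ->
  n%:R^-1 * (1 / 4 * pi_max R n ^+ n.-1 * (pi_min R n / 8) ^+ 2) <= vgen (Pi_of R H) H'.
Proof.
move=> hamH [[x [l [Ul szl -> jl]]] _ _ _ _ _ _ _ _].
have [s def_s] := listingP Ul szl.
have P0 := Pi_of_pos R n_gt3 H.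
(* A single listing of [H'], the one with few jumps, is kept; its start vertex gives the factor
   [1 / n]. *)
rewrite /vgen (bigD1 s) /=; last by rewrite cyc_edgesE def_s.
rewrite ler_wpDr ?sumr_ge0 // => [s' _|]; first exact: order_prob_ge0.
rewrite /order_prob def_s ler_wpM2l ?invr_ge0 ?ler0n //.
have [_] := path_prob_ge hamH Ul; apply: le_trans.
have -> : size l = n.-1 by apply: succn_inj; rewrite szl prednK //; exact: leq_trans n_gt3.
have M0 := pi_max_gt0 R n_gt3; have [m0 m1 _ n1] := pi_min_max.
have c0 : 0 <= 1 / 4 :> R by lra.
have m80 : 0 <= pi_min R n / 8 by lra.
have m81 : pi_min R n / 8 <= 1 by lra.
by rewrite ler_wpM2l ?ler_wiXn2l // mulr_ge0 // exprn_ge0 // ltW.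
Qed.

End Vertex.

(** * Edge-based generation *)

Section Edge.
Variables (R : realType) (n : nat).
Hypothesis n_gt3 : (3 < n)%N.
Implicit Types (u v : 'I_n) (e f : {set 'I_n}) (B H : {set {set 'I_n}}).
Implicit Types (P : 'I_n -> 'I_n -> R) (F : {set {set 'I_n}} -> R).

Let n_gt1 : (1 < n)%N. Proof. exact: leq_trans n_gt3. Qed.
Let n_gt2 : (2 < n)%N. Proof. exact: leq_trans n_gt3. Qed.

Lemma ew_set2 P u v : u != v -> ew P [set u; v] = P u v + P v u.
Proof.
move=> uv; rewrite /ew big_setU1 ?inE //= big_set1 !big_mkcondr /=.
rewrite !(big_setU1, big_set1) ?inE //= ?eqxx /= (eq_sym v) uv add0r addr0 //.
Qed.

Lemma adm_set2 B f : admissible B f -> exists u v, u != v /\ f = [set u; v].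
Proof. by case/and4P=> /cards2P[u [v [uv ->]]] _ _ _; exists u, v. Qed.

Lemma adm_notin B f : admissible B f -> f \notin B.
Proof. by case/and4P. Qed.

Lemma ew_gt0 P B f : positive_weights P -> admissible B f -> 0 < ew P f.
Proof.
by case=> _ P0 /adm_set2[u [v [uv ->]]]; rewrite ew_set2 // addr_gt0 ?P0 // eq_sym.
Qed.

Lemma Zadm_ge0 P B : positive_weights P -> 0 <= Zadm P B.
Proof. by move=> P0; apply: sumr_ge0 => f /(ew_gt0 P0)/ltW. Qed.

(** The process as a Markov chain: the mean of [F] after [k] further additions to [B]. Unlike the
    sum over sequences in [egen], it allows induction on the current set. *)
Fixpoint expect P F B k : R :=
  if k is k'.+1 then \sum_(f | admissible B f) ew P f / Zadm P B * expect P F (f |: B) k'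
  else F B.

Lemma sum_eseq P F B k :
  \sum_(t : k.-tuple {set 'I_n}) eseq_prob P B t * F ([set x | x \in t] :|: B) = expect P F B k.
Proof.
elim: k B => [|k IHk] B /=.
  rewrite (big_pred1 [tuple]) => [|t]; last by apply/esym/eqP; rewrite tuple0.
  by rewrite /= mul1r; congr F; apply/setP=> x; rewrite !inE.
rewrite (reindex (fun p : {set 'I_n} * k.-tuple {set 'I_n} => [tuple of p.1 :: p.2])) /=; last first.
  exists (fun t : k.+1.-tuple _ => (thead t, [tuple of behead t])) => [[f t] _ | t _] /=.
    by congr (_, _); apply: val_inj.
  by rewrite [RHS]tuple_eta; apply: val_inj.
rewrite -(pair_bigA _ (fun f (t : k.-tuple _) => eseq_prob P B (f :: t)
  * F ([set x | x \in [tuple of f :: t]] :|: B))) /= [RHS]big_mkcond /=.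
apply: eq_bigr => f _; case: ifP => _; last by rewrite big1 // => t _; rewrite !mul0r.
rewrite -IHk mulr_sumr; apply: eq_bigr => t _; rewrite mulrA; congr (_ * F _).
by apply/setP=> x; rewrite !inE orbCA orbA.
Qed.

Lemma egenE P H : egen P H = expect P (fun B => (B == H)%:R) finset.set0 n.
Proof.
rewrite -sum_eseq /egen big_mkcond; apply: eq_bigr => t _.
by rewrite setU0; case: eqP; rewrite ?mulr1 ?mulr0.
Qed.

Lemma expect_ge0 P F B k : positive_weights P -> (forall C, 0 <= F C) -> 0 <= expect P F B k.
Proof.
move=> P0 F0; elim: k B => [|k IHk] B //=; apply: sumr_ge0 => f adm.
by rewrite mulr_ge0 // divr_ge0 ?Zadm_ge0 // ltW // (ew_gt0 P0 adm).
Qed.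

Lemma sub_adm H B : is_ham H -> B \subset H -> (#|B| < n)%N ->
  exists2 f, f \in H & admissible B f.
Proof.
move=> hamH sBH ltB; have /subsetPn[f fH fNB] : ~~ (H \subset B).
  by apply: contraL ltB => /subset_leq_card; rewrite (card_ham n_gt2 hamH) -leqNgt.
by exists f => //; apply: (admissible_ham n_gt1 hamH) => //; rewrite subUset sub1set fH.
Qed.

Lemma Zadm_gt0 P H B : positive_weights P -> is_ham H -> B \subset H -> (#|B| < n)%N ->
  0 < Zadm P B.
Proof.
move=> P0 hamH sBH /(sub_adm hamH sBH)[f _ admf].
rewrite /Zadm (bigD1 f) //= ltr_wpDr ?(ew_gt0 P0 admf) //.
by apply: sumr_ge0 => g /andP[/(ew_gt0 P0)/ltW].
Qed.

Lemma card_adm B f : admissible B f -> #|f |: B| = #|B|.+1.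
Proof. by move/adm_notin => fNB; rewrite cardsU1 fNB. Qed.

(** A tour around [B] guarantees an admissible edge at every step; [admissible_extend] renews it
    after each addition. *)
Lemma expect1 P H B k : positive_weights P -> is_ham H -> B \subset H -> (#|B| + k <= n)%N ->
  expect P (fun=> 1) B k = 1.
Proof.
move=> P0; elim: k H B => [|k IHk] H B hamH sBH le_n //=.
have Z0 : 0 < Zadm P B by apply: Zadm_gt0 hamH sBH _; rewrite // (leq_trans _ le_n) // addnS ltnS leq_addr.
rewrite (eq_bigr (fun f => ew P f / Zadm P B)) => [|f admf]; last first.
  have [H' hamH' sub] := admissible_extend hamH sBH admf.
  by rewrite (IHk H') ?mulr1 // (card_adm admf) addSnnS.
by rewrite -mulr_suml divff // gt_eqF.
Qed.

Lemma expect_ham P H H0 B k : is_ham H -> B \subset H -> (#|B| + k = n)%N ->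
  expect P (fun C => (C == H0)%:R) B k != 0 -> is_ham H0.
Proof.
elim: k H B => [|k IHk] H B hamH sBH def_n /=.
  have -> : B = H by apply: (sub_ham_eq n_gt2) => //; move: def_n; rewrite addn0 => ->.
  by case: (H =P H0) => [<- // | _]; rewrite eqxx.
apply: contraNT => hamN; rewrite big1 // => f admf.
have [H' hamH' sub] := admissible_extend hamH sBH admf.
apply/eqP; rewrite mulf_eq0; apply/orP; right; apply: contraNT hamN.
by apply: (IHk H'); rewrite // (card_adm admf) addSnnS.
Qed.

Lemma egen_distr P : positive_weights P -> ham_distr (@egen R n) P.
Proof.
move=> P0; have ham0 := ham_star n; split=> [H | | H].
- by rewrite egenE expect_ge0 // => C; rewrite ler0n.
- rewrite -[RHS](@expect1 P (star n) finset.set0 n) ?sub0set ?cards0 //.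
  rewrite -sum_eseq (partition_big (fun t : n.-tuple _ => [set x | x \in t]) xpredT) //=.
  by apply: eq_bigr => H _; apply: eq_bigr => t _; rewrite mulr1.
rewrite egenE; apply: expect_ham ham0 _ _; rewrite ?sub0set ?cards0 //.
Qed.

(** * Reaching the exchanged tour edge by edge *)

Section Exchange.
Variables (H H' : {set {set 'I_n}}) (e g1 g2 g3 a b : {set 'I_n}).
Hypotheses (hamH : is_ham H) (eNH : e \notin H) (ex : exchange H e H' g1 g2 g3 a b).

Local Notation m := (pi_min R n).
Local Notation M := (pi_max R n).
(** Price of one step for the admissible edges outside [H]; [n] such factors stay above
    [exp (- 12)]. *)
Local Notation D := ((1 + 12 * n%:R^-1)^-1 : R).
Local Notation I := (H :&: H').
Local Notation reach := (expect (Pi_of R H) (fun C => (C == H')%:R)).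

Let hamH' : is_ham H'.
Proof. by have [x [l [Ul szl -> _]]] := ex_listing ex; apply/ham_listP; exists (x :: l). Qed.

Let P0 := Pi_of_pos R n_gt3 H.

Lemma ew_Pi_of B f : admissible B f -> ew (Pi_of R H) f = 2 * (if f \in H then M else m).
Proof.
case/adm_set2=> u [v [uv ->]]; rewrite ew_set2 // /Pi_of (negPf uv) eq_sym (negPf uv).
by rewrite (setUC [set v]) mulr2n mulrDl mul1r.
Qed.

Lemma Zadm_le B h : B \subset H' -> (#|[set f in H | admissible B f]| <= h)%N ->
  Zadm (Pi_of R H) B <= 2 * M * h%:R + 4 * m * ((n - #|B|) ^ 2)%:R.
Proof.
move=> sBH' le_h; have M0 := pi_max_gt0 R n_gt3; have m0 := pi_min_gt0 R n_gt3.
apply: le_trans (_ : \sum_(f | admissible B f) (2 * M * (f \in H)%:R + 2 * m) <= _).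
  by apply: ler_sum => f /ew_Pi_of->; case: ifP => _ /=; lra.
rewrite big_split /= -mulr_sumr -natr_sum; apply: lerD.
  rewrite ler_pM2l ?mulr_gt0 // ler_nat; apply: leq_trans le_h.
  rewrite -sum1_card big_mkcond [leqRHS]big_mkcond /=; apply: leq_sum => f _.
  by rewrite inE; case: (admissible B f); case: (f \in H).
rewrite (eq_bigl (mem [set f | admissible B f])) => [|f]; last by rewrite /= inE.
rewrite sumr_const -[_ *+ _]mulr_natr.
have := card_admissible n_gt3 hamH' sBH'; rewrite -(ler_nat R) natrM.
by rewrite -(ler_pM2l (x := 2 * m)) ?mulr_gt0 //; lra.
Qed.

Lemma D_gt0 : 0 < D.
Proof. by rewrite invr_gt0 ltr_wpDr // mulr_ge0 // invr_ge0 ler0n. Qed.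

Lemma D_le1 : D <= 1.
Proof. by rewrite invf_le1 ?lerDl ?ltr_wpDr // mulr_ge0 // invr_ge0 ler0n. Qed.

(** The edges outside [H] add [4 * m * r ^ 2 <= 8 * m * h * n <= 16 * h / n], where [r = n - #|B|].
    The constant 12 in [D] leaves room for [24 * M * h / n >= 18 * h / n], since [M >= 3 / 4]. *)
Lemma Zadm_leD B h : B \subset H' -> (#|[set f in H | admissible B f]| <= h)%N ->
  ((n - #|B|) ^ 2 <= 2 * h * n)%N -> Zadm (Pi_of R H) B <= 2 * M * h%:R / D.
Proof.
move=> sBH' le_h le_r; apply: le_trans (Zadm_le sBH' le_h) _.
have [m0 m1 defM n4] := pi_min_max R n_gt3.
have M34 := pi_max_ge R n_gt3.
have nm : m * n%:R <= 2 * n%:R^-1.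
  have def_n : n%:R = n.-2%:R + 2 :> R.
    by rewrite -natrD; congr _%:R; move: n_gt3; clear; lia.
  have -> : m * n%:R = n.-2%:R * m + 2 * m by rewrite def_n; ring.
  by rewrite pi_min_mul //; lra.
have le_rR : ((n - #|B|) ^ 2)%:R <= 2 * h%:R * n%:R :> R by rewrite -!natrM ler_nat.
have h0 : 0 <= h%:R :> R by rewrite ler0n.
have : m * ((n - #|B|) ^ 2)%:R <= m * (2 * h%:R * n%:R) by rewrite ler_pM2l.
have : h%:R * (m * n%:R) <= h%:R * (2 * n%:R^-1) by rewrite ler_wpM2l.
have n0 : 0 <= h%:R * n%:R^-1 :> R by rewrite mulr_ge0 ?invr_ge0 ?ler0n.
have : 3 / 4 * (h%:R * n%:R^-1) <= M * (h%:R * n%:R^-1) by rewrite ler_wpM2r.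
rewrite invrK; lra.
Qed.

Lemma reach_ge B k (S : {set {set 'I_n}}) (z : R) : {in S, forall f, admissible B f} ->
  0 < Zadm (Pi_of R H) B -> Zadm (Pi_of R H) B <= z ->
  \sum_(f in S) ew (Pi_of R H) f / z * reach (f |: B) k <= reach B k.+1.
Proof.
move=> admS Z0 Zz /=; rewrite [leRHS](bigID (mem S)) /= ler_wpDr //.
  apply: sumr_ge0 => f /andP[admf _]; rewrite mulr_ge0 ?divr_ge0 ?(ltW Z0) //.
    exact/ltW/(ew_gt0 P0 admf).
  by apply: expect_ge0 => // C; rewrite ler0n.
rewrite [leRHS](eq_bigl (mem S)) => [|f]; last first.
  by rewrite /=; case fS: (f \in S); rewrite ?andbF // admS.
apply: ler_sum => f /admS admf; rewrite ler_wpM2r //.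
  by apply: expect_ge0 => // C; rewrite ler0n.
by rewrite ler_pM2l ?(ew_gt0 P0 admf) // lef_pV2 // posrE ?(lt_le_trans Z0).
Qed.

Lemma adm_lost B f : f \in H -> admissible B f -> f \in I :\: B \/ f \in [set g1; g2; g3].
Proof.
move=> fH admf; case fH': (f \in H'); first by left; rewrite !inE (adm_notin admf) fH.
by right; apply: (subsetP (ex_lost ex)); rewrite !inE fH fH'.
Qed.

Lemma adm_new B f : B \subset H' -> f \in H' -> f \notin B -> admissible B f.
Proof.
move=> sBH' fH' fNB; apply: (admissible_ham n_gt1 hamH') => //.
by rewrite subUset sub1set fH'.
Qed.

Lemma card_I_ge : (n <= #|I| + 3)%N.
Proof.
have := cardsID H' H; rewrite (card_ham n_gt2 hamH).
have : (#|H :\: H'| <= 3)%N.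
  apply: leq_trans (subset_leq_card (ex_lost ex)) _.
  by rewrite -setUA !cardsU1 cards1; do 2!case: (_ \notin _).
by clear; lia.
Qed.

Lemma eNI : e \notin I. Proof. by rewrite inE (negPf eNH). Qed.

Lemma card_I_lt : (#|I| < n)%N.
Proof.
have /subset_leq_card : e |: I \subset H' by rewrite subUset sub1set (ex_new ex) // subsetIr.
by rewrite cardsU1 eNI (card_ham n_gt2 hamH').
Qed.

(** With [e] and all common edges present, the lost edges of [H] are blocked, so all admissible
    edges weigh the same. At most two edges are missing, hence at most 8 are admissible, and one of
    [H'] is picked with probability at least [1 / 8]. *)
Lemma reach_final B k : B \subset H' -> e |: I \subset B -> (#|B| + k = n)%N ->
  (1 / 8) ^+ k <= reach B k.
Proof.
elim: k B => [|k IHk] B sBH' sIB def_n.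
  have -> : B = H' by apply: (sub_ham_eq n_gt2) => //; move: def_n; rewrite addn0 => ->.
  by rewrite /= eqxx.
have eB : e \in B by rewrite (subsetP sIB) ?setU11.
have sIB' : I \subset B by apply: subset_trans sIB; apply: subsetUr.
have m0 := pi_min_gt0 R n_gt3.
have ltB : (#|B| < n)%N by move: def_n; clear; lia.
have [f fH' admf] := sub_adm hamH' sBH' ltB.
have k2 : (k.+1 <= 2)%N.
  have := subset_leq_card sIB; rewrite cardsU1 eNI add1n.
  by move: card_I_ge def_n; move: #|I| #|B| => i c; clear; lia.
have no_old : [set f in H | admissible B f] = finset.set0.
  apply/setP=> x; rewrite !inE; apply/negP=> /andP[xH admx].
  case: (adm_lost xH admx) => [/setDP[xI]|]; first by rewrite (subsetP sIB').
  rewrite !inE -orbA => /or3P[]/eqP def_x; move: (admx); apply/negP; rewrite def_x.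
  - by apply: (ex_g1 ex) => //; rewrite (subsetP sIB') ?(ex_a ex).
  - by apply: (ex_g2 ex) => //; rewrite (subsetP sIB') ?(ex_b ex).
  apply: contra (ex_g3 ex); apply: admissible_subset; rewrite //.
  by rewrite -def_x (contra (subsetP sIB _)) ?(adm_notin admx).
have Z0 := Zadm_gt0 P0 hamH' sBH' ltB.
have Zle : Zadm (Pi_of R H) B <= 2 * m * 8.
  have := @Zadm_le B 0 sBH'; rewrite no_old cards0 => /(_ isT).
  have : ((n - #|B|) ^ 2)%:R <= 4 :> R.
    by rewrite (ler_nat R _ 4); move: def_n k2; clear=> def_n k2; rewrite (leq_sqr _ 2); lia.
  rewrite -(ler_pM2l m0); lra.
have fNH : f \notin H.
  apply/negP=> fH; have : f \in [set f in H | admissible B f] by rewrite inE fH.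
  by rewrite no_old inE.
have := @reach_ge B k [set f] _ _ Z0 Zle; rewrite big_set1 => le_reach.
apply: le_trans (le_reach _) => [|x]; last by rewrite inE => /eqP->.
have {}IHk : (1 / 8) ^+ k <= reach (f |: B) k.
  apply: IHk; rewrite ?(card_adm admf) ?addSnnS //; first by rewrite subUset sub1set fH'.
  exact: subset_trans sIB (subsetUr _ _).
rewrite exprS ler_pM ?exprn_ge0 //; try by lra.
rewrite (ew_Pi_of admf) (negPf fNH) invfM mulrA divff ?mul1r //.
by rewrite gt_eqF // mulr_gt0.
Qed.

Lemma card_sub_e B : e \in B -> (n <= #|B| + #|I :\: B| + 2)%N.
Proof.
move=> eB; have /subset_leq_card : e |: (I :&: B) \subset B.
  by rewrite subUset sub1set eB subsetIr.
have cardI : (#|I :&: B| + #|I :\: B| = #|I|)%N := cardsID B I.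
rewrite cardsU1 in_setI (negPf eNI) add1n.
move: card_I_ge cardI; move: #|I| #|I :&: B| #|I :\: B| #|B| => i ib d c.
by clear; lia.
Qed.

Lemma sum_eq1 (X : {set {set 'I_n}}) x : (\sum_(f in X) (f == x) = (x \in X))%N.
Proof.
transitivity (\sum_(f | f == x) (f \in X : nat))%N; last by rewrite big_pred1_eq.
by rewrite big_mkcond [RHS]big_mkcond; apply: eq_bigr => f _; case: (f \in X); case: (f == x).
Qed.

(** Induction step of [reach_mid] with [x = j + 1]: of a total of [x + 1 + s], the common edges
    count [x + s], as a missing [a] or [b] counts double. *)
Lemma mid_ineq (x s : R) : 0 < x -> 0 <= s -> (x + 1)^-1 <= (x + s) / ((x + 1 + s) * x).
Proof.
move=> x0 s0; rewrite -subr_ge0.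
have -> : (x + s) / ((x + 1 + s) * x) - (x + 1)^-1 = s / ((x + 1 + s) * x * (x + 1)).
  by field; rewrite !gt_eqF //; lra.
by rewrite divr_ge0 // !mulr_ge0 //; lra.
Qed.

Lemma kept_weight (h : nat) B f : (0 < h)%N -> admissible B f -> f \in H ->
  ew (Pi_of R H) f / (2 * M * h%:R / D) = D / h%:R.
Proof.
move=> h0 admf fH; rewrite (ew_Pi_of admf) fH.
have M0 := pi_max_gt0 R n_gt3; have D0 := D_gt0.
move: (D) D0 => d D0; field.
by rewrite !gt_eqF // ltr0n.
Qed.

(* With [j] common edges still missing, each of them is chosen with probability about
   [1 / (j + 1 + s)], where [s] counts the missing ones among [a] and [b]; as the product
   telescopes, only a factor of order [1 / (j + 1)] is lost. *)
Lemma reach_mid j B k : B \subset H' -> e \in B -> (#|B| + k = n)%N -> #|I :\: B| = j ->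
  1 / 64 * D ^+ j * (1 / 2) ^+ ((a \notin B) + (b \notin B)) * (j.+1%:R)^-1 <= reach B k.
Proof.
elim: j B k => [|j IHj] B k sBH' eB def_n cardX.
  have sIB : I \subset B by rewrite -setD_eq0 -cards_eq0 cardX.
  rewrite !(subsetP sIB) ?(ex_a ex) ?(ex_b ex) // !mulr1 invr1 mulr1.
  (* At most two final choices give [1 / 64 = (1 / 8) ^ 2]. *)
  apply: le_trans (_ : (1 / 8) ^+ k <= _); last by apply: reach_final; rewrite // subUset sub1set eB.
  have k2 : (k <= 2)%N by have := card_sub_e eB; rewrite cardX; move: def_n; clear; lia.
  case: k k2 {def_n} => [|[|[]]] // _; rewrite ?expr0 ?expr1 ?expr2; lra.
set s := ((a \notin B) + (b \notin B))%N.
set X := I :\: B in cardX *.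
have sXH' : X \subset H' by apply: subset_trans (subsetDl _ _) (subsetIr _ _).
have sXH : X \subset H by apply: subset_trans (subsetDl _ _) (subsetIl _ _).
have admX : {in X, forall f, admissible B f}.
  by move=> f fX; apply: adm_new; rewrite ?(subsetP sXH') //; case/setDP: fX.
have ltB : (#|B| < n)%N.
  rewrite ltnNge; apply/negP=> leB; have defB := sub_ham_eq n_gt2 hamH' sBH' leB.
  have /card_gt0P[f /setDP[/setIP[_ fH'] fNB]] : (0 < #|X|)%N by rewrite cardX.
  by rewrite defB fH' in fNB.
case: k def_n => [|k] def_n; first by rewrite addn0 in def_n; rewrite def_n ltnn in ltB.
(* The [j + 1] missing common edges, [g3], and [g1] or [g2] as long as [a] or [b], respectively, is
   missing. *)
pose h := (j.+2 + s)%N.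
have le_h : (#|[set f in H | admissible B f]| <= h)%N.
  pose Y := X :|: (if a \in B then finset.set0 else [set g1])
              :|: (if b \in B then finset.set0 else [set g2]) :|: [set g3].
  apply: leq_trans (_ : #|Y| <= _)%N.
    apply: subset_leq_card; apply/subsetP=> f; rewrite inE => /andP[fH admf].
    case: (adm_lost fH admf) => [fX | ]; first by rewrite !in_setU fX.
    rewrite !inE -orbA => /or3P[] /eqP def_f; rewrite {1}def_f in admf.
    - have -> : a \in B = false by apply: contraTF admf => aB; apply: (ex_g1 ex).
      by rewrite def_f !inE eqxx !orbT.
    - have -> : b \in B = false by apply: contraTF admf => bB; apply: (ex_g2 ex).
      by rewrite def_f [in X in X || _]in_set1 eqxx !orbT.
    by rewrite def_f eqxx !orbT.
  have U (A C : {set {set 'I_n}}) : (#|A :|: C| <= #|A| + #|C|)%N by case: (leq_card_setU A C).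
  apply: leq_trans (U _ _) _; rewrite cards1 addn1 /h !addSn !ltnS.
  apply: leq_trans (U _ _) _; rewrite /s addnA -addSn leq_add //.
    by apply: leq_trans (U _ _) _; rewrite cardX leq_add2l; case: (a \in B); rewrite ?cards0 ?cards1.
  by case: (b \in B); rewrite ?cards0 ?cards1.
have Zle : Zadm (Pi_of R H) B <= 2 * M * h%:R / D.
  apply: Zadm_leD => //; have := card_sub_e eB; rewrite -/X cardX => le_n.
  rewrite -mulnn leq_mul ?leq_subr //.
  by move: le_n; rewrite /h; clear; lia.
have Z0 := Zadm_gt0 P0 hamH' sBH' ltB.
apply: le_trans (reach_ge k admX Z0 Zle).
have D0 := D_gt0.
set w := 1 / 64 * D ^+ j * (1 / 2) ^+ s * (j.+1%:R)^-1.
have c64 : 0 <= 1 / 64 :> R by lra.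
have c2 : 0 <= 1 / 2 :> R by lra.
have c0 := mulr_ge0 (mulr_ge0 c64 (exprn_ge0 j (ltW D0))) (exprn_ge0 s c2).
(* Picking [a] or [b] removes a factor [1 / 2] from the bound of the induction hypothesis, so these
   two count double. *)
apply: le_trans (_ : \sum_(f in X) D / h%:R * w * (1 + (f == a) + (f == b))%:R <= _); last first.
  apply: ler_sum => f fX; rewrite (kept_weight _ (admX f fX)) ?(subsetP sXH) //.
  rewrite -[leLHS]mulrA ler_pM2l ?divr_gt0 ?ltr0n //.
  have cardXf : #|I :\: (f |: B)| = j.
    have := cardsD1 f X; rewrite fX cardX => -[->]; congr #|pred_of_set _|.
    by rewrite ?/X setDDl setUC.
  apply: le_trans (IHj (f |: B) k _ _ _ cardXf); first last.
  - by rewrite (card_adm (admX f fX)) addSnnS.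
  - by rewrite in_setU1 eB orbT.
  - by rewrite subUset sub1set (subsetP sXH').
  have E2 (x y z : R) : x * (1 / 2 * y) * z * 2%:R = x * y * z by field.
  rewrite /w /s !in_setU1 !negb_or.
  have fNB : f \notin B by case/setDP: fX.
  have [fa|fa] := eqVneq f a; have [fb|fb] := eqVneq f b.
  - by move: (ex_ab ex); rewrite -fa -fb eqxx.
  - by rewrite -fa fNB /= add1n add0n exprS -[(1 + true + false)%N]/2%N E2.
  - by rewrite -[(1 + false + true)%N]/2%N -fb fNB /= addn1 addn0 exprS E2.
  by rewrite /= -[(1 + false + false)%N]/1%N mulr1.
rewrite -mulr_sumr -natr_sum big_split big_split /= sum1_card cardX !sum_eq1.
have -> : (j.+1 + (a \in X) + (b \in X) = j.+1 + s)%N.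
  by rewrite /X !in_setD (ex_a ex) (ex_b ex) !andbT addnA.
have x0 : 0 < j.+1%:R :> R by rewrite ltr0n.
have E1 : j.+1%:R + 1 = j.+2%:R :> R by rewrite natr1.
have := mid_ineq x0 (ler0n R s); rewrite E1.
have -> : j.+2%:R + s%:R = h%:R :> R by rewrite -natrD.
rewrite natrD invfM => ineq.
have := ler_wpM2l (mulr_ge0 (ltW D0) c0) ineq; rewrite /w exprS.
have E (x1 x2 x3 x4 x5 : R) : x1 * (x2 * x3) * x4 * x5 = x2 * (x1 * x3 * x4) * x5 by ring.
have E' (x1 x2 x3 x4 x5 : R) : x1 * x2 * (x3 * x4) * x5 = x1 * x3 * (x5 * (x2 * x4)) by ring.
by rewrite E E'.
Qed.

(** Induction step of [reach_start] with [x = j]: the first summand stands for picking [e] now, the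
    second for picking one of the [j] missing common edges. *)
Lemma start_ineq (x : R) : 0 <= x -> 1 / 512 <= 1 / 256 / (x + 1) + x * (1 / 512 / (x + 2)).
Proof.
move=> x0; rewrite -subr_ge0.
have -> : 1 / 256 / (x + 1) + x * (1 / 512 / (x + 2)) - 1 / 512 = 1 / 256 / ((x + 1) * (x + 2)).
  by field; rewrite !gt_eqF //; lra.
by rewrite divr_ge0 // ?mulr_ge0 //; lra.
Qed.

(* While [e] is not yet chosen, each step picks it with probability about
   [pi_min / (j + 3)], where [j] common edges are missing. *)
Lemma reach_start_step j B k : B \subset I -> (#|B| + k.+1 = n)%N -> #|I :\: B| = j ->
  (forall f, f \in I :\: B -> m / 512 * D ^+ j / j.+2%:R <= reach (f |: B) k) ->
  m / 512 * D ^+ j.+1 / j.+3%:R <= reach B k.+1.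
Proof.
set X := I :\: B => sBI def_n cardX IH.
have sBH' : B \subset H' by apply: subset_trans sBI (subsetIr _ _).
have sBH : B \subset H by apply: subset_trans sBI (subsetIl _ _).
have sXH' : X \subset H' by apply: subset_trans (subsetDl _ _) (subsetIr _ _).
have sXH : X \subset H by apply: subset_trans (subsetDl _ _) (subsetIl _ _).
have eNB : e \notin B by apply: contra eNH; apply: (subsetP sBH).
have eNX : e \notin X by apply: contra eNH; apply: (subsetP sXH).
have ltB : (#|B| < n)%N by move: def_n; clear; lia.
have adm_e : admissible B e by apply: adm_new; rewrite ?(ex_new ex).
have admX : {in X, forall f, admissible B f}.
  by move=> f fX; apply: adm_new; rewrite ?(subsetP sXH') //; case/setDP: fX.
have admS : {in e |: X, forall f, admissible B f}.
  by move=> f; rewrite in_setU1 => /predU1P[-> | /admX].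
have cardB : (#|B| + j = #|I|)%N.
  by have := cardsID B I; rewrite (setIidPr sBI) -/X cardX.
have le_r : (n - #|B| <= j.+3)%N.
  by move: card_I_ge cardB; move: #|I| #|B| => i c; clear; lia.
have le_h : (#|[set f in H | admissible B f]| <= j.+3)%N.
  apply: leq_trans le_r; rewrite -[X in (X - _)%N](card_ham n_gt2 hamH).
  have := cardsID B H; rewrite (setIidPr sBH) => <-; rewrite addKn.
  apply: subset_leq_card; apply/subsetP=> f; rewrite inE => /andP[fH admf].
  by rewrite inE fH (adm_notin admf).
have Zle : Zadm (Pi_of R H) B <= 2 * M * j.+3%:R / D.
  apply: Zadm_leD => //; rewrite -mulnn leq_mul ?leq_subr //.
  by apply: leq_trans le_r _; clear; lia.
have Z0 := Zadm_gt0 P0 hamH' sBH' ltB.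
apply: le_trans (reach_ge k admS Z0 Zle); rewrite big_setU1 //=.
have D0 := D_gt0; have m0 := pi_min_gt0 R n_gt3; have M0 := pi_max_gt0 R n_gt3.
have L0 : 0 < D / j.+3%:R by rewrite divr_gt0 ?ltr0n.
have wt_e : m * (D / j.+3%:R) <= ew (Pi_of R H) e / (2 * M * j.+3%:R / D).
  rewrite (ew_Pi_of adm_e) (negPf eNH).
  have -> : 2 * m / (2 * M * j.+3%:R / D) = m / M * (D / j.+3%:R).
    have h0 : 0 < j.+3%:R :> R by rewrite ltr0n.
    by move: (D) (j.+3%:R : R) D0 h0 => d h D0 h0; field; rewrite !gt_eqF.
  rewrite ler_pM2r // ler_pdivlMr // ler_piMr ?(ltW m0) //.
  exact: pi_max_lt1.
(* From [reach_mid], with [1 / 256 = 1 / 64 * (1 / 2) ^ 2] in case both [a] and [b] are missing. *)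
have reach_e : 1 / 256 * D ^+ j / j.+1%:R <= reach (e |: B) k.
  have cardXe : #|I :\: (e |: B)| = j.
    rewrite -cardX; congr #|pred_of_set _|; apply/setP=> x; rewrite !inE.
    by case: eqP => // ->; rewrite (negPf eNH) /= !andbF.
  apply: le_trans (reach_mid _ _ _ cardXe); first last.
  - by rewrite (card_adm adm_e) addSnnS.
  - exact: setU11.
  - by rewrite subUset sub1set (ex_new ex).
  rewrite ler_pM2r ?invr_gt0 ?ltr0n // [leRHS]mulrAC ler_pM2r ?exprn_gt0 //.
  set s := (_ + _)%N; have : (s <= 2)%N by rewrite /s; do 2!case: (_ \notin _).
  by case: s => [|[|[|//]]] _; rewrite ?expr0 ?expr1 ?expr2; lra.
have sum_X : j%:R * (D / j.+3%:R * (m / 512 * D ^+ j / j.+2%:R))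
    <= \sum_(f in X) ew (Pi_of R H) f / (2 * M * j.+3%:R / D) * reach (f |: B) k.
  have <- : #|X|%:R = j%:R :> R by rewrite cardX.
  rewrite mulr_natl -sumr_const; apply: ler_sum => f fX.
  by rewrite (kept_weight _ (admX f fX)) ?(subsetP sXH) // ler_pM2l //; apply: IH.
apply: le_trans (lerD _ sum_X); last first.
  apply: ler_pM wt_e reach_e; first by rewrite mulr_ge0 ?(ltW m0) ?(ltW L0).
  have c256 : 0 <= 1 / 256 :> R by lra.
  by rewrite mulr_ge0 ?invr_ge0 ?ler0n // mulr_ge0 // exprn_ge0 ?(ltW D0).
have := start_ineq (ler0n R j); rewrite natr1 -natrD addn2 => ineq.
have c0 := mulr_ge0 (mulr_ge0 (ltW m0) (ltW L0)) (exprn_ge0 j (ltW D0)).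
have := ler_wpM2l c0 ineq; rewrite exprS.
move: (D ^+ j) (j.+3%:R : R)^-1 (j.+1%:R : R)^-1 (j.+2%:R : R)^-1 => d x3 x1 x2.
by move: (D) => d1; lra.
Qed.

Lemma reach_start j B k : B \subset I -> (#|B| + k = n)%N -> #|I :\: B| = j ->
  m / 512 * D ^+ j.+1 / j.+3%:R <= reach B k.
Proof.
elim: j B k => [|j IHj] B [|k] sBI def_n cardX.
(* For [k = 0] the set [B] would have [n] edges inside [I], which has fewer. *)
1,3: by have := subset_leq_card sBI; have := card_I_lt; move: def_n; move: #|I| #|B| => i c; clear; lia.
  by apply: reach_start_step => // f; move/eqP: cardX; rewrite cards_eq0 => /eqP->; rewrite inE.
apply: reach_start_step => // f fX; apply: IHj.
- by rewrite subUset sub1set sBI; case/setDP: fX => ->.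
- have fNB : f \notin B by case/setDP: fX.
  by rewrite cardsU1 fNB addSnnS.
have := cardsD1 f (I :\: B); rewrite fX cardX => -[->]; congr #|pred_of_set _|.
by rewrite ?/X setDDl setUC.
Qed.

Lemma egen_exchange : m / 512 * D ^+ n / n.+2%:R <= egen (Pi_of R H) H'.
Proof.
have m0 := pi_min_gt0 R n_gt3; have D0 := D_gt0; have D1 := D_le1.
rewrite egenE; apply: le_trans (reach_start _ _ erefl); rewrite ?sub0set ?cards0 //.
rewrite setD0; have ltI := card_I_lt.
apply: ler_pM; rewrite ?invr_ge0 ?ler0n //.
- by rewrite mulr_ge0 ?exprn_ge0 ?(ltW D0) //; lra.
- by rewrite ler_pM2l ?ler_wiXn2l ?(ltW D0) //; lra.
by rewrite lef_pV2 ?posrE ?ltr0n // ler_nat !ltnS.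
Qed.

End Exchange.
End Edge.

(** * Asymptotics *)

From mathcomp Require Import all_classical all_reals all_analysis.
Unset Implicit Arguments.
Import Order.TTheory GRing.Theory Num.Theory.
Local Open Scope ring_scope.

Section Asymptotics.
Variable R : realType.

Lemma inv1D_ge (x : R) k : 0 <= x -> expR (- (x * k%:R)) <= (1 + x)^-1 ^+ k.
Proof.
move=> x0; have x1 : 0 < 1 + x by rewrite ltr_pwDl.
rewrite -mulNr expRM_natr lerXn2r ?nnegrE ?expR_ge0 ?invr_ge0 ?(ltW x1) //.
by rewrite expRN lef_pV2 ?posrE ?expR_gt0 // expR_ge1Dx.
Qed.

(** Follows from [exp z >= z ^ 2 / 2] at [z = eps * ln n], as soon as [ln n] reaches the threshold
    [t]. *)
Lemma ln_le_powR (K eps : R) : 0 < K -> 0 < eps ->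
  exists n0 : nat, forall n : nat, (n0 <= n)%N -> (0 < n)%N -> ln n%:R <= K * n%:R `^ eps.
Proof.
move=> K0 eps0; pose t := 2 / (K * eps ^+ 2).
have c0 : 0 < K * eps ^+ 2 by rewrite mulr_gt0 ?exprn_gt0.
exists (Num.bound (expR t)) => n le_n n_gt0.
have n0 : 0 < n%:R :> R by rewrite ltr0n.
have le_t : t <= ln n%:R.
  rewrite -(expRK t) ler_ln ?posrE ?expR_gt0 //.
  apply: le_trans (ltW (archi_boundP (expR_ge0 t))) _.
  by rewrite ler_nat.
set y := ln _ in le_t *; rewrite /powR gt_eqF // -/y.
have t0 : 0 < t by rewrite divr_gt0.
have y0 : 0 < y by exact: lt_le_trans le_t.
have le_exp : (eps * y) ^+ 2 / 2 <= expR (eps * y).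
  have := @expR_ge1Dxn R (eps * y) 1; rewrite mulr_ge0 ?(ltW eps0) ?(ltW y0) // => /(_ isT).
  by apply: le_trans; rewrite lerDr.
apply: le_trans (_ : K * ((eps * y) ^+ 2 / 2) <= _); last by rewrite ler_pM2l.
have -> : K * ((eps * y) ^+ 2 / 2) = K * eps ^+ 2 / 2 * y * y by field.
rewrite ler_peMl ?(ltW y0) //.
by move: le_t; rewrite /t ler_pdivrMr // => le_t; rewrite mulrAC ler_pdivlMr // mul1r mulrC.
Qed.

Variable gen : forall n, ('I_n -> 'I_n -> R) -> {set {set 'I_n}} -> R.
Hypothesis gen_distr : forall n, (3 < n)%N -> forall P, positive_weights P -> ham_distr (@gen n) P.
Variables (c : R) (d : nat).
Hypotheses (c_gt0 : 0 < c) (c_le1 : c <= 1).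
Hypothesis gen_closer : forall n, (3 < n)%N -> forall H, is_ham H -> H != star n ->
  exists2 H', (#|H :&: star n| < #|H' :&: star n|)%N & c / n%:R ^+ d <= @gen n (Pi_of R H) H'.

(** With [p = c / n ^ d], all samples of one iteration fail with probability at most [exp (- 2 y)].
    One half of this exponent absorbs the factor [n = exp (ln n)] of the union bound; hence
    [c / 2]. *)
Lemma prob_found_exp n N (sel : selector n N) : (3 < n)%N -> valid_selector R sel ->
  ln n%:R <= c / 2 * N%:R / n%:R ^+ d ->
  1 - expR (- (c / 2 * N%:R / n%:R ^+ d)) <= prob_found_within (@gen n) sel n.
Proof.
move=> n_gt3 val_sel le_ln; set y := c / 2 * _ / _ in le_ln *.
have n0 : 0 < n%:R :> R by rewrite ltr0n (leq_trans _ n_gt3).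
have nd1 : 1 <= n%:R ^+ d :> R by rewrite exprn_ege1 // ler1n -(ltr0n R).
pose p := c / n%:R ^+ d.
have p1 : p <= 1 by rewrite ler_pdivrMr ?mul1r ?(le_trans c_le1) // (lt_le_trans ltr01).
apply: le_trans (_ : 1 - (1 - p) ^+ N *+ n <= _); last first.
  apply: prob_found_ge => //.
  - by apply: gen_distr => //; apply: Pi0_pos.
  - by move=> H hamH; apply: gen_distr => //; apply: Pi_of_pos.
  exact: gen_closer.
rewrite lerD2l lerN2.
have le_exp : (1 - p) ^+ N <= expR (- (y + y)).
  have -> : - (y + y) = - p * N%:R.
    rewrite /y /p; move: (n%:R ^+ d) (lt_le_trans ltr01 nd1) => z z0.
    by field; rewrite gt_eqF.
  rewrite expRM_natr lerXn2r ?nnegrE ?expR_ge0 ?subr_ge0 //.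
  exact: expR_ge1Dx.
rewrite -mulr_natr -[X in _ * X](lnK (x := n%:R)) ?posrE //.
apply: le_trans (_ : expR (- (y + y)) * expR (ln n%:R) <= _); first by rewrite ler_wpM2r ?expR_ge0.
by rewrite -expRD ler_expR; lra.
Qed.

(** [N / n ^ d] grows at least like [n ^ eps], which dominates [ln n]. *)
Lemma prob_found_asymptotic (eps : R) (Nf : nat -> nat) : 0 < eps < 1 ->
  (exists c1 : R, 0 < c1 /\ exists n0 : nat, forall n : nat, (n0 <= n)%N ->
     c1 * (n%:R `^ (d%:R + eps)) <= (Nf n)%:R) ->
  exists c' : R, 0 < c' /\ exists n1 : nat, forall n : nat, (n1 <= n)%N -> (4 <= n)%N ->
    forall sel : selector n (Nf n), valid_selector R sel ->
      1 - expR (- (c' * (Nf n)%:R / n%:R ^+ d)) <= prob_found_within (@gen n) sel n.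
Proof.
move=> /andP[eps0 _] [c1 [c1_gt0 [n0 leN]]]; exists (c / 2); split; first by rewrite divr_gt0.
have K0 : 0 < c / 2 * c1 by rewrite mulr_gt0 ?divr_gt0.
have [n1 le_ln] := ln_le_powR _ _ K0 eps0; exists (maxn n0 n1) => n.
rewrite geq_max => /andP[le0 le1] n_gt3 sel val_sel; apply: prob_found_exp => //.
have n_gt0 : 0 < n%:R :> R by rewrite ltr0n (leq_trans _ n_gt3).
apply: le_trans (le_ln n le1 _) _; first exact: leq_trans n_gt3.
rewrite ler_pdivlMr ?exprn_gt0 // -!mulrA ler_pM2l // ler_pM2l ?invr_gt0 //.
apply: le_trans (leN n le0); rewrite powRD; last by rewrite (gt_eqF n_gt0) implybT.
by rewrite powR_mulrn ?(ltW n_gt0) // ler_pM2l // mulrC.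
Qed.

End Asymptotics.

(** * Constants for the two generation methods *)

Lemma pi_min_ge (R : realType) n : (3 < n)%N -> (n%:R ^+ 2)^-1 <= pi_min R n.
Proof.
move=> n_gt3; have n4 := n_ge4 R n_gt3; rewrite pi_minE // lef_pV2 ?posrE.
- by rewrite expr2 ler_pM2l; lra.
- by rewrite exprn_gt0; lra.
by rewrite mulr_gt0; lra.
Qed.

Lemma vgen_closer (R : realType) n : (3 < n)%N -> forall H, is_ham H -> H != star n ->
  exists2 H', (#|H :&: star n| < #|H' :&: star n|)%N
            & expR (- 1) / 256 / n%:R ^+ 5 <= vgen (Pi_of R H) H'.
Proof.
move=> n_gt3 H hamH neqH.
have [e [H' [g1 [g2 [g3 [a [b [eNH ex clH']]]]]]]] := exchange_star n_gt3 hamH neqH.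
exists H' => //; apply: le_trans (vgen_exchange R n_gt3 hamH ex).
have n4 := n_ge4 R n_gt3; have n0 : 0 < n%:R :> R by lra.
(* [pi_max] is the inverse of [1 + 1 / (n - 1)], whose power [n - 1] is at most [exp 1]. *)
have M_ge : expR (- 1) <= pi_max R n ^+ n.-1.
  have def_n : n%:R - 1 = n.-1%:R :> R by rewrite -subn1 natrB // (leq_trans _ n_gt3).
  have -> : pi_max R n = (1 + (n%:R - 1)^-1)^-1.
    rewrite /pi_max; move: (n%:R : R) n4 {def_n n0} => x x4.
    by field; rewrite !gt_eqF //; lra.
  have n1 : 0 < n%:R - 1 :> R by lra.
  have := @inv1D_ge R (n%:R - 1)^-1 n.-1; rewrite -def_n mulVf ?gt_eqF //; apply.
  by rewrite invr_ge0 ltW.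
have m2 : (n%:R ^+ 2)^-1 ^+ 2 <= pi_min R n ^+ 2.
  by rewrite lerXn2r ?nnegrE ?pi_min_ge ?invr_ge0 ?exprn_ge0 ?(ltW n0) // ltW // pi_min_gt0.
(* 256 collects the 4 of the path bound and [8 ^ 2] for two jumps; [n ^ 5] is [n] for the start
   vertex times [n ^ 2] for each jump. *)
have E (x y : R) : 0 < x -> y / 256 / x ^+ 5 = x^-1 * (1 / 4 * y * ((x ^+ 2)^-1 ^+ 2 / 64)).
  by move=> x0; field; rewrite gt_eqF.
rewrite {}E //.
have c4 : 0 <= 1 / 4 :> R by lra.
rewrite ler_pM2l ?invr_gt0 //; apply: ler_pM.
- by rewrite mulr_ge0 ?expR_ge0.
- by rewrite divr_ge0 ?exprn_ge0 ?invr_ge0 ?exprn_ge0 ?(ltW n0).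
- by rewrite ler_wpM2l.
have E8 : 8 ^+ 2 = 64 :> R by ring.
by rewrite expr_div_n E8 ler_pM2r // invr_gt0.
Qed.

Lemma egen_closer (R : realType) n : (3 < n)%N -> forall H, is_ham H -> H != star n ->
  exists2 H', (#|H :&: star n| < #|H' :&: star n|)%N
            & expR (- 12) / 1024 / n%:R ^+ 3 <= egen (Pi_of R H) H'.
Proof.
move=> n_gt3 H hamH neqH.
have [e [H' [g1 [g2 [g3 [a [b [eNH ex clH']]]]]]]] := exchange_star n_gt3 hamH neqH.
exists H' => //; apply: le_trans (egen_exchange R n_gt3 hamH eNH ex).
have n4 := n_ge4 R n_gt3; have n0 : 0 < n%:R :> R by lra.
have D_ge : expR (- 12) <= (1 + 12 * n%:R^-1)^-1 ^+ n :> R.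
  have := @inv1D_ge R (12 * n%:R^-1) n; rewrite mulfVK ?gt_eqF //; apply.
  by rewrite mulr_ge0 ?invr_ge0 ?(ltW n0).
(* Here [1024 = 512 * 2], where the 2 comes from [n + 2 <= 2 * n]. *)
have E (x y : R) : 0 < x -> y / 1024 / x ^+ 3 = (x ^+ 2)^-1 / 512 * y * (2 * x)^-1.
  by move=> x0; field; rewrite gt_eqF.
rewrite {}E //.
have k0 : 0 < 512^-1 :> R by lra.
move: (512^-1 : R) k0 => k k0.
have i2 : 0 <= (n%:R ^+ 2)^-1 :> R by rewrite invr_ge0 exprn_ge0 ?(ltW n0).
apply: ler_pM.
- exact: mulr_ge0 (mulr_ge0 i2 (ltW k0)) (expR_ge0 _).
- by rewrite invr_ge0 mulr_ge0 ?(ltW n0).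
- apply: ler_pM; [exact: mulr_ge0 i2 (ltW k0) | exact: expR_ge0 | | exact: D_ge].
  by rewrite ler_pM2r // pi_min_ge.
have le2n : n.+2%:R <= 2 * n%:R :> R by rewrite -addn2 natrD; lra.
have n2 : 0 < n.+2%:R :> R by rewrite ltr0n.
by rewrite lef_pV2 ?posrE // (lt_le_trans n2).
Qed.

Theorem theorem1 (R : realType) :
  (* (a) vertex-based generation *)
  (forall (eps : R), 0 < eps < 1 ->
   forall Nf : nat -> nat,
   (exists c : R, 0 < c /\ exists n0 : nat, forall n : nat, (n0 <= n)%N ->
        c * (n%:R `^ (5 + eps)) <= (Nf n)%:R) ->
   exists c' : R, 0 < c' /\ exists n1 : nat, forall n : nat, (n1 <= n)%N -> (4 <= n)%N ->
     forall sel : selector n (Nf n), valid_selector R sel ->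
       1 - expR (- (c' * (Nf n)%:R / n%:R ^+ 5))
         <= prob_found_within (@vgen R n) sel n)
  /\
  (* (b) edge-based generation *)
  (forall (eps : R), 0 < eps < 1 ->
   forall Nf : nat -> nat,
   (exists c : R, 0 < c /\ exists n0 : nat, forall n : nat, (n0 <= n)%N ->
        c * (n%:R `^ (3 + eps)) <= (Nf n)%:R) ->
   exists c' : R, 0 < c' /\ exists n1 : nat, forall n : nat, (n1 <= n)%N -> (4 <= n)%N ->
     forall sel : selector n (Nf n), valid_selector R sel ->
       1 - expR (- (c' * (Nf n)%:R / n%:R ^+ 3))
         <= prob_found_within (@egen R n) sel n).
Proof.
have const (x k : R) : 0 <= x -> 1 <= k -> 0 < expR (- x) / k /\ expR (- x) / k <= 1.
  move=> x0 k1; have k0 := lt_le_trans ltr01 k1; split; first by rewrite divr_gt0 ?expR_gt0.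
  by rewrite ler_pdivrMr // mul1r (le_trans _ k1) // -expR0 ler_expR oppr_le0.
split=> eps eps01 Nf leN.
- have [||c0 c1] := const 1 256; try by lra.
  apply: (@prob_found_asymptotic R (@vgen R) _ _ 5 c0 c1 _ eps Nf eps01 leN).
    by move=> n n_gt3 P; apply: vgen_distr.
  exact: vgen_closer.
have [||c0 c1] := const 12 1024; try by lra.
apply: (@prob_found_asymptotic R (@egen R) _ _ 3 c0 c1 _ eps Nf eps01 leN).
  by move=> n n_gt3 P; apply: egen_distr.
exact: egen_closer.
Qed.
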